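(* Let $H$ be a real separable Hilbert space, let $L=(L_t)_{t\ge 0}$ be an $H$-valued Lévy process with generating triplet $(m,Q,\nu)$, and let $(P_t)_{t\ge 0}$ be its transition semigroup, $P_tf(x)=\mathbb{E}\,f(x+L_t)$. Let $q\in L^2(H,\mathcal{B}(H),\nu)$. Then for all $t>0$ and all $f\in B_b(H)$ one has $P_tf\in\mathcal{D}_q$ and $$ \left\vert A_qP_tf(x)\right\vert^2\le \frac1t\,P_tf^2(x)\int_H q^2(y)\,\nu(\mathrm{d}y)\qquad\text{for all }x\in H. $$
   Context: $B_b(H)$ is the space of bounded Borel measurable functions $f\colon H\to\mathbb{R}$, and $\mathcal{B}(H)$ is the Borel $\sigma$-algebra of $H$. Generating triplet: $m\in H$, $Q\colon H\to H$ is a symmetric non-negative trace class operator, and $\nu$ (the Lévy measure) is a Borel measure on $H$ with $\nu(\{0\})=0$ and $\int_H 1\wedge|y|_H^2\,\nu(\mathrm{d}y)<\infty$, such that $\mathbb{E}\,e^{\mathrm{i}\langle x,L_t\rangle_H}=e^{-t\psi(x)}$ for $x\in H$, $t\ge0$, where $$\psi(x)=-\mathrm{i}\langle x,m\rangle_H+\tfrac12\langle Qx,x\rangle_H-\int_H\left[e^{\mathrm{i}\langle x,y\rangle_H}-1-\mathrm{i}\langle x,y\rangle_H\mathbf{1}_{\{|y|_H\le1\}}\right]\nu(\mathrm{d}y).$$ The transition semigroup is $P_tf(x)=\mathbb{E}\,f(x+L_t)$ for $t\ge0$, $x\in H$, $f\in B_b(H)$; $P_tf^2$ means $P_t(f^2)$.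 For $q\in L^2(H,\mathcal{B}(H),\nu)$ put $$\mathcal{D}_q=\left\{f\in B_b(H)\colon\ \sup_{x\in H}\int_H|f(x+y)-f(x)|\,|q(y)|\,\nu(\mathrm{d}y)<\infty\right\},$$ $$A_qf(x)=\int_H\left[f(x+y)-f(x)\right]q(y)\,\nu(\mathrm{d}y),\qquad f\in\mathcal{D}_q,\ x\in H.$$ *)

(* Defs.v *)
From HB Require Import structures.
From mathcomp Require Import all_boot all_order all_algebra finmap.
From mathcomp Require Import all_classical all_reals all_analysis.
From mathcomp Require Import complex.

Set Implicit Arguments.
Unset Strict Implicit.
Unset Printing Implicit Defensive.

Import Order.TTheory GRing.Theory Num.Theory.
Import numFieldNormedType.Exports.

Local Open Scope classical_set_scope.
Local Open Scope ring_scope.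

Definition separable (T : topologicalType) :=
  exists2 D : set T, countable D & dense D.

Definition borel (T : ptopologicalType) := g_sigma_algebraType (@open T).

Section complex_valued.
Context {R : realType}.
Local Open Scope complex_scope.

Definition cexp (z : R[i]) : R[i] :=
  (expR (complex.Re z))%:C * (cos (complex.Im z) +i* sin (complex.Im z)).

Definition cintegral d (T : measurableType d) (mu : {measure set T -> \bar R})
    (f : T -> R[i]) : R[i] :=
  (\int[mu]_x complex.Re (f x)) +i* (\int[mu]_x complex.Im (f x)).

End complex_valued.

Section independence.
Context d d' (T : measurableType d) (T' : measurableType d') (R : realType).

Definition independent_family (P : probability T R) (I : choiceType)
    (X : I -> T -> T') :=
  forall (J : {fset I}) (A : I -> set T'), (forall i, measurable (A i)) ->
  P (\bigcap_(i in [set` J]) X i @^-1` A i) =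
  (\prod_(i <- J) P (X i @^-1` A i))%E.

End independence.

Section levy.
Context {R : realType} {H : completeNormedModType R}.
Context d (Omega : measurableType d) (P : probability Omega R).

(* Only the values L t with 0 <= t matter. In levy_independent, every finite
   partition 0 <= t_0 < ... < t_n extends to an infinite increasing sequence
   and, conversely, independent_family only looks at finite subfamilies. *)
Record levy_process (L : R -> Omega -> H) : Prop := {
  levy_measurable : forall t : R, 0 <= t ->
    measurable_fun [set: Omega] (L t : Omega -> borel H) ;
  levy_start : {ae P, forall w, L 0 w = 0} ;
  levy_independent : forall t : nat -> R, 0 <= t 0%N ->
    (forall i, t i < t i.+1) ->
    independent_family P
      (fun i w => (L (t i.+1) w - L (t i) w : borel H)) ;
  levy_stationary : forall s t : R, 0 <= s -> s <= t ->
    forall A : set (borel H), measurable A ->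
    P [set w | A (L t w - L s w)] = P [set w | A (L (t - s) w)] ;
  levy_stochastically_continuous : forall t e : R, 0 <= t -> 0 < e ->
    P [set w | e < `|L s w - L t w|]
      @[s --> within [set s | 0 <= s] (nbhs t)] --> 0%E }.

Definition transition (L : R -> Omega -> H) (t : R) (f : H -> R) (x : H) : R :=
  fine 'E_P[fun w => f (x + L t w)].

End levy.

Section triplet.
Context {R : realType} {H : completeNormedModType R} (ip : H -> H -> R).
Local Open Scope complex_scope.

Definition symmetric_operator (Q : H -> H) := forall x y, ip (Q x) y = ip x (Q y).

Definition nonnegative_operator (Q : H -> H) := forall x, 0 <= ip (Q x) x.

(* Nuclear representation Q = \sum_k <., a_k> b_k; it entails boundedness. *)
Definition trace_class (Q : H -> H) :=
  exists a b : nat -> H,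
    cvgn (series (fun k => `|a k| * `|b k| : R)) /\
    forall x, series (fun k => ip x (a k) *: b k) @ \oo --> Q x.

Definition levy_measure (nu : {measure set (borel H) -> \bar R}) :=
  nu [set 0 : H] = 0%E /\
  (\int[nu]_y (Num.min 1 (`|y : H| ^+ 2))%:E < +oo)%E.

Definition levy_exponent (m : H) (Q : H -> H)
    (nu : {measure set (borel H) -> \bar R}) (x : H) : R[i] :=
  - 'i%C * (ip x m)%:C + (ip (Q x) x / 2)%:C
  - cintegral nu (fun y : borel H =>
      cexp ('i%C * (ip x y)%:C) - 1
      - 'i%C * (ip x y * \1_[set z : H | `|z| <= 1] y)%:C).

Definition generating_triplet d (Omega : measurableType d)
    (P : probability Omega R) (L : R -> Omega -> H)
    (m : H) (Q : {linear H -> H}) (nu : {measure set (borel H) -> \bar R}) :=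
  [/\ symmetric_operator Q, nonnegative_operator Q, trace_class Q,
      levy_measure nu &
      forall (x : H) (t : R), 0 <= t ->
        cintegral P (fun w => cexp ('i%C * (ip x (L t w))%:C)) =
        cexp (- (t%:C * levy_exponent m Q nu x))].

End triplet.

Section operators.
Context {R : realType} {H : completeNormedModType R}.
Context (nu : {measure set (borel H) -> \bar R}) (q : borel H -> R).

Definition bounded_borel : set (H -> R) :=
  [set f | measurable_fun [set: borel H] (f : borel H -> R) /\ bounded_fun f].

Definition Dq : set (H -> R) :=
  [set f | bounded_borel f /\
    (ereal_sup (range (fun x : H =>
       \int[nu]_y (`|f (x + y) - f x| * `|q y|)%:E)) < +oo)%E].

Definition Aq (f : H -> R) (x : H) : R :=
  \int[nu]_y ((f (x + y) - f x) * q y).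

End operators.

(* Main.v *)
(** Write [P_t] for the transition semigroup and [mu_s] for the law of [L_s].
For a trigonometric polynomial [f] telescoping along [t = n s] gives
[P_t f^2 - (P_t f)^2 = sum_(i < n) P_(i s) (P_s g_i^2 - (P_s g_i)^2)] with
[g_i = P_(t - (i + 1) s) f].  Each summand is a variance under [mu_s], hence at least
[2 Cov (g_i, q) - mu_s (q^2)] for every test function [q], and [P_(i s)] maps the
covariance to one that does not depend on [i].  Dividing by [s] and letting [s] tend
to [0], [mu_s / s] converges to [nu] on trigonometric polynomials vanishing to third
order at [0] (the drift and Gaussian parts disappear), so that
[t * \int (2 g q - q^2) dnu <= P_t f^2] at the origin, with
[g y = P_t f y - P_t f 0].  Trigonometric polynomials generate all bounded Borel
functions under bounded pointwise limits, so the inequality extends to bounded Borel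
[f] and [q = g] off small sets, i.e. [t * \int g^2 dnu <= P_t f^2].  Translating the
origin to [x] and applying Cauchy-Schwarz finishes the proof. *)

Require Import Defs.
From mathcomp Require Import all_boot all_order all_algebra.
From mathcomp Require Import all_classical all_reals all_analysis.
From mathcomp Require Import measurable_realfun ring lra complex.

Set Implicit Arguments.
Unset Strict Implicit.
Unset Printing Implicit Defensive.

Import Order.TTheory GRing.Theory Num.Theory.
Import numFieldNormedType.Exports.

Local Open Scope classical_set_scope.
Local Open Scope ring_scope.

(** * Bounded pointwise closure of an algebra of functions *)

(** The laws of the process are handled through their characteristic functions. In real form, time
    [r] acts on [cos (ip x y + th)] by a damping factor and a phase shift, so the semigroup law and
    the commutation of [P_r] with covariances reduce to trigonometric identities. The obstacle is at
    the origin: [nu] may have infinite mass there, and the small-time law also carries drift and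
    diffusion. The optimal test function, the increment [g] itself, is neither a trigonometric
    polynomial nor flat enough at 0. Test functions are therefore written [q = rho * p], where [rho]
    is a finite sum of [(1 - cos (ip e_k y))^2] over a dense sequence [e_k]. This weight is a
    trigonometric polynomial of fourth order at 0 and is [nu]-integrable. With [rho] fixed, a
    constant times [|rho|] dominates every integrand, so [f] and [p] can pass to bounded Borel
    functions. Then [p = g / rho] is allowed where [rho >= 1/(n+1)], and these sets increase to the
    complement of 0, where [g] vanishes anyway. Since [q = g] maximizes [2 g q - q^2] pointwise,
    this choice gives the constant [1/t]. *)

Section bounded_closure.
Context {R : realType} {T : Type}.
Implicit Types (A : set (T -> R)) (f g : T -> R).

(** As an inductive predicate it allows limits of limits to any depth, and a property stable under
    dominated convergence passes from [A] to the whole closure by induction. The uniform bound in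
    each limit step is what supplies the dominating constant. *)
Inductive bclosure A : (T -> R) -> Prop :=
| bclosure_base f : A f -> bclosure A f
| bclosure_lim (u : nat -> T -> R) (M : R) f :
    (forall n, bclosure A (u n)) -> (forall n x, `|u n x| <= M) ->
    (forall x, u ^~ x @ \oo --> f x) -> bclosure A f.

Record bounded_algebra A : Prop := {
  balg_bounded : forall f, A f -> exists M, forall x, `|f x| <= M ;
  balg1 : A (fun=> 1) ;
  balgD : forall f g, A f -> A g -> A (fun x => f x + g x) ;
  balgZ : forall c f, A f -> A (fun x => c * f x) ;
  balgM : forall f g, A f -> A g -> A (fun x => f x * g x) }.

Lemma cvg_norm_le (u : nat -> R) (l M : R) :
  (forall n, `|u n| <= M) -> u @ \oo --> l -> `|l| <= M.
Proof.
move=> uM ul; have nul : `|u n| @[n --> \oo] --> `|l| by exact: cvg_norm.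
rewrite -(cvg_lim _ nul)//; apply: limr_le; first exact: cvgP nul.
by near=> n; exact: uM.
Unshelve. all: by end_near.
Qed.

Context A (algA : bounded_algebra A).
Local Notation cl := (bclosure A).

Lemma bclosure_bounded f : cl f -> exists M, forall x, `|f x| <= M.
Proof.
case=> [g /(balg_bounded algA)//|u M g _ uM ug].
by exists M => x; exact: cvg_norm_le (ug x).
Qed.

Lemma bclosureZ c f : cl f -> cl (fun x => c * f x).
Proof.
elim=> [g Ag|u M g _ IH uM ug]; first by apply: bclosure_base; exact: balgZ.
apply: (@bclosure_lim _ (fun n x => c * u n x) (`|c| * M)) => //.
- by move=> n x; rewrite normrM ler_wpM2l.
- by move=> x; apply: cvgMr; exact: ug.
Qed.

(** Two nested inductions: a limit in [f] is taken against an arbitrary [g] of the closure, which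
    leaves [f] in [A] and a second induction on [g]. Products are treated in the same way. *)
Lemma bclosureD f g : cl f -> cl g -> cl (fun x => f x + g x).
Proof.
elim=> [{}f Af|u M {}f _ IH uM uf] clg; last first.
  have [N gN] := bclosure_bounded clg.
  apply: (@bclosure_lim _ (fun n x => u n x + g x) (M + N)).
  - by move=> n; exact: IH.
  - by move=> n x; rewrite (le_trans (ler_normD _ _))// lerD.
  - by move=> x; apply: cvgD; [exact: uf|exact: cvg_cst].
elim: clg => [{}g Ag|u M {}g _ IH uM ug]; first by apply: bclosure_base; exact: balgD.
have [N fN] := balg_bounded algA Af.
apply: (@bclosure_lim _ (fun n x => f x + u n x) (N + M)) => //.
- by move=> n x; rewrite (le_trans (ler_normD _ _))// lerD.
- by move=> x; apply: cvgD; [exact: cvg_cst|exact: ug].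
Qed.

Lemma bclosureM f g : cl f -> cl g -> cl (fun x => f x * g x).
Proof.
elim=> [{}f Af|u M {}f _ IH uM uf] clg; last first.
  have [N gN] := bclosure_bounded clg.
  apply: (@bclosure_lim _ (fun n x => u n x * g x) (M * N)).
  - by move=> n; exact: IH.
  - by move=> n x; rewrite normrM ler_pM.
  - by move=> x; apply: cvgMl; exact: uf.
elim: clg => [{}g Ag|u M {}g _ IH uM ug]; first by apply: bclosure_base; exact: balgM.
have [N fN] := balg_bounded algA Af.
apply: (@bclosure_lim _ (fun n x => f x * u n x) (N * M)) => //.
- by move=> n x; rewrite normrM ler_pM.
- by move=> x; apply: cvgMr; exact: ug.
Qed.

Lemma bclosure_cst c : cl (fun=> c).
Proof.
by have := bclosureZ c (bclosure_base (balg1 algA)); under eq_fun do rewrite mulr1.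
Qed.

Lemma bclosureB f g : cl f -> cl g -> cl (fun x => f x - g x).
Proof.
move=> clf clg; have := bclosureD clf (bclosureZ (-1) clg).
by under eq_fun do rewrite mulN1r.
Qed.

Lemma bclosureX n f : cl f -> cl (fun x => f x ^+ n).
Proof.
move=> clf; elim: n => [|n IH]; first exact: bclosure_cst.
by under eq_fun do rewrite exprS; exact: bclosureM.
Qed.

Lemma bclosure_sum n (F : nat -> T -> R) : (forall i, cl (F i)) ->
  cl (fun x => \sum_(i < n) F i x).
Proof.
move=> clF; elim: n => [|n IH].
  by under eq_fun do rewrite big_ord0; exact: bclosure_cst.
by under eq_fun do rewrite big_ord_recr/=; exact: bclosureD.
Qed.

(* The iteration p <- p + (a^2 - p^2) / 2 started at 0 increases to |a|. *)
Fixpoint sqrt_iter (a : R) n : R :=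
  if n is n'.+1 then sqrt_iter a n' + (a ^+ 2 - sqrt_iter a n' ^+ 2) / 2 else 0.

(** With [k = |a|], one step multiplies the error [k - p] by [1 - (k + p) / 2], which is nonnegative
    because [p <= k <= 1] and at most [1 - k / 2] because [p >= 0]. *)
Lemma sqrt_iter_bound a n : `|a| <= 1 ->
  0 <= sqrt_iter a n <= `|a| /\
  `|a| - sqrt_iter a n <= `|a| * (1 - `|a| / 2) ^+ n.
Proof.
have := normr_ge0 a; have -> : sqrt_iter a n = sqrt_iter `|a| n.
  by elim: n => //= n ->; rewrite (real_normK (num_real a)).
move: `|a| => k k0 k1; elim: n => [|n [/andP[IH1 IH2] IH3]] /=.
  by rewrite expr0; split; lra.
set p := sqrt_iter k n in IH1 IH2 IH3 *.
split; first by apply/andP; split; nra.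
rewrite [_ ^+ n.+1]exprS mulrCA; set e := k * _ in IH3 *.
have -> : k - (p + (k ^+ 2 - p ^+ 2) / 2) = (1 - (k + p) / 2) * (k - p) by field.
by apply: ler_pM; lra.
Qed.

Lemma sqrt_iter_cvg a : `|a| <= 1 -> sqrt_iter a n @[n --> \oo] --> `|a|.
Proof.
(* At [a = 0] the contraction factor is 1 and gives no decay, but the iteration is constantly 0. *)
move=> a1; have [->|a0] := eqVneq a 0.
  rewrite normr0 (_ : sqrt_iter 0 = fun=> 0) ?funeqE//; first exact: cvg_cst.
  by elim=> //= n ->; rewrite expr0n/= subrr mul0r addr0.
have k0 : 0 < `|a| by rewrite normr_gt0.
apply: (@squeeze_cvgr _ _ _ _ (fun n => `|a| - `|a| * (1 - `|a| / 2) ^+ n)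
  (fun=> `|a|)).
- near=> n; have [/andP[_ ->] h] := sqrt_iter_bound n a1.
  by rewrite andbT; lra.
- rewrite -[X in _ --> X]subr0; apply: cvgB; first exact: cvg_cst.
  rewrite -[X in _ --> X](mulr0 `|a|); apply: cvgMr; apply: cvg_expr.
  by rewrite ger0_norm; lra.
- exact: cvg_cst.
Unshelve. all: by end_near.
Qed.

(** After rescaling [f] into [[-1, 1]], each iterate of [sqrt_iter] is a polynomial in [f], hence in
    the closure, and the iterates converge boundedly. The divisor [|M| + 1] is positive whatever the
    bound [M] is. *)
Lemma bclosure_norm f : cl f -> cl (fun x => `|f x|).
Proof.
move=> clf; have [M fM] := bclosure_bounded clf.
pose N := `|M| + 1; have N0 : 0 < N by rewrite /N; have := normr_ge0 M; lra.
pose g x := N^-1 * f x.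
have g1 x : `|g x| <= 1.
  rewrite /g normrM gtr0_norm ?invr_gt0// ler_pdivrMl// mulr1.
  by rewrite (le_trans (fM x))// /N; have := ler_norm M; lra.
have clp n : cl (fun x => sqrt_iter (g x) n).
  elim: n => [|n IH] /=; first exact: bclosure_cst.
  apply: bclosureD => //; under eq_fun do rewrite mulrC.
  by apply/bclosureZ/bclosureB; apply: bclosureX => //; exact: bclosureZ.
have : cl (fun x => `|g x|).
  apply: (bclosure_lim (M := 1) clp) => [n x|x]; last exact: sqrt_iter_cvg.
  have [/andP[h0 h1] _] := sqrt_iter_bound n (g1 x).
  by rewrite ger0_norm// (le_trans h1).
move=> /(bclosureZ N); congr cl; apply/funext => x.
by rewrite /g normrM gtr0_norm ?invr_gt0// mulVKf ?gt_eqF.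
Qed.

(** Let [h] be the positive part of [f - c], scaled into [[0, 1]]. Then [1 - (1 - h)^n] tends to 1
    where [h > 0] and is 0 where [h = 0]. *)
Lemma bclosure_gt f c : cl f -> cl \1_[set x | c < f x].
Proof.
move=> clf; pose h x := (`|f x - c| + (f x - c)) / 2.
have clh : cl h.
  have clc : cl (fun x => f x - c) by apply: bclosureB => //; exact: bclosure_cst.
  rewrite /h; under eq_fun do rewrite mulrC.
  by apply/bclosureZ/bclosureD => //; exact: bclosure_norm.
have h0 x : 0 <= h x by rewrite /h; have := ler_norm (- (f x - c)); rewrite normrN; lra.
have hgt x : (0 < h x) = (c < f x).
  rewrite /h; case: (ltP c (f x)) => fc.
    by rewrite ger0_norm; lra.
  by rewrite ler0_norm; lra.
have [M hM] := bclosure_bounded clh.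
pose N := `|M| + 1; have N0 : 0 < N by rewrite /N; have := normr_ge0 M; lra.
have hN x : h x <= N.
  by rewrite /N; have := hM x; have := ler_norm M; have := ler_norm (h x); lra.
apply: (@bclosure_lim _ (fun n x => 1 - (1 - N^-1 * h x) ^+ n) 1).
- move=> n; apply: bclosureB; first exact: bclosure_cst.
  by apply/bclosureX/bclosureB; [exact: bclosure_cst|exact: bclosureZ].
- move=> n x; have a0 : 0 <= N^-1 * h x by rewrite mulr_ge0// invr_ge0 ltW.
  have a1 : N^-1 * h x <= 1 by rewrite ler_pdivrMl// mulr1.
  have b0 : 0 <= (1 - N^-1 * h x) ^+ n by rewrite exprn_ge0// subr_ge0.
  have b1 : (1 - N^-1 * h x) ^+ n <= 1 by rewrite exprn_ile1//; lra.
  by rewrite ger0_norm; lra.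
- move=> x; rewrite indicE; have [xh|xh] := ltP c (f x).
    rewrite mem_set// -[X in _ --> X]subr0; apply: cvgB; first exact: cvg_cst.
    apply: cvg_expr; rewrite -hgt in xh.
    have a0 : 0 < N^-1 * h x by rewrite mulr_gt0// invr_gt0.
    have a1 : N^-1 * h x <= 1 by rewrite ler_pdivrMl// mulr1.
    by rewrite ger0_norm; lra.
  rewrite memNset/=; last by apply/negP; rewrite -leNgt.
  have -> : h x = 0 by apply/eqP; rewrite eq_le h0 andbT leNgt hgt -leNgt.
  rewrite mulr0 subr0 (_ : (fun n => _) = (fun=> 0)); first exact: cvg_cst.
  by apply/funext => n; rewrite expr1n subrr.
Qed.

Definition bclosure_sets : set (set T) := [set B | cl \1_B].

Lemma sigma_algebra_bclosure_sets : sigma_algebra setT bclosure_sets.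
Proof.
have cC B : bclosure_sets B -> bclosure_sets (~` B).
  move=> cB; rewrite /bclosure_sets/= (_ : \1_(~` B) = fun x => 1 - \1_B x).
    by apply: bclosureB => //; exact: bclosure_cst.
  by apply/funext => x; rewrite !indicE in_setC; case: (_ \in _); rewrite /= ?subr0 ?subrr.
have cI B C : bclosure_sets B -> bclosure_sets C -> bclosure_sets (B `&` C).
  by rewrite /bclosure_sets/= indicI; exact: bclosureM.
have c0 : bclosure_sets set0.
  by rewrite /bclosure_sets/= indic0; exact: bclosure_cst.
split => //= [B|F cF]; first by rewrite setTD; exact: cC.
have cU n : bclosure_sets (\big[setU/set0]_(i < n) F i).
  elim: n => [|n IH]; rewrite ?big_ord0// big_ord_recr/=.
  by rewrite -[_ `|` _]setCK setCU; apply/cC/cI; apply/cC.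
apply: (bclosure_lim (M := 1) cU) => [n x|x].
  by rewrite indicE; case: (_ \in _); rewrite ?normr1 ?normr0.
have [[k _ Fk]|nF] := pselect ((\bigcup_k F k) x).
  rewrite indicE mem_set; last by exists k.
  apply: cvg_near_cst; exists k.+1 => // n /= kn; rewrite indicE mem_set//.
  by rewrite -bigcup_mkord; exists k.
rewrite indicE memNset//; apply: cvg_near_cst; near=> n.
rewrite indicE memNset// -bigcup_mkord => -[k _ Fk].
by apply: nF; exists k.
Unshelve. all: by end_near.
Qed.

End bounded_closure.

Section bclosure_measurable.
Context {R : realType} d (T : measurableType d).
Variable A : set (T -> R).

Lemma measurable_bclosure (f : T -> R) : (forall g, A g -> measurable_fun setT g) ->
  bclosure A f -> measurable_fun setT f.
Proof.
move=> mA; elim=> [g /mA//|u M g _ IH uM ug].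
exact: (measurable_fun_cvg IH (fun x _ => ug x)).
Qed.

Lemma measurable_superlevel (h : T -> R) c : measurable_fun setT h ->
  measurable [set x | c <= h x].
Proof.
move=> mh; rewrite (_ : [set x | _] = h @^-1` `[c, +oo[%classic).
  by rewrite -[X in measurable X]setTI; apply: mh => //; exact: measurable_itv.
by apply/seteqP; split => x /=; rewrite in_itv/= andbT.
Qed.

(** The sum is the minimum of [n] and the integer part of [y], written as a sum of indicators of
    superlevel sets so that a discretized function visibly lies in the closure. *)
Lemma floor_layers (y : R) n : 0 <= y ->
  let s : R := \sum_(i < n) (i.+1%:R <= y)%R%:R in
  if n%:R <= y then s = n%:R else s <= y <= s + 1.
Proof.
move=> y0 /=; elim: n => [|n]; first by rewrite big_ord0 y0.
rewrite big_ord_recr/=; have [ny|ny] := leP n%:R y.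
  move=> ->; have [ny1|ny1] := leP n.+1%:R y; first by rewrite -natr1.
  by rewrite addr0 ny/= natr1 ltW.
have ny1 : y < n.+1%:R by rewrite (lt_trans ny)// ltr_nat.
by rewrite (lt_geF ny1) addr0.
Qed.

Lemma bclosure_of_measurable (f : T -> R) : bounded_algebra A ->
  (forall B : set T, measurable B -> bclosure A \1_B) ->
  measurable_fun setT f -> (exists M, forall x, `|f x| <= M) -> bclosure A f.
Proof.
move=> algA mA mf [M fM].
pose N := `|M| + 1; have N0 : 0 < N by rewrite /N; have := normr_ge0 M; lra.
(* The range stays strictly below 1, so [(n+1) * g < n+1]: the first case of [floor_layers] is
   excluded and [u n] is within [1/(n+1)] of [g]. *)
pose g x := (f x / N + 1) / 2.
have g01 x : 0 <= g x < 1.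
  have : `|f x / N| < 1.
    rewrite normrM normfV (gtr0_norm N0) ltr_pdivrMr// mul1r /N.
    by have := fM x; have := ler_norm M; lra.
  by rewrite ltr_norml /g; lra.
suff clg : bclosure A g.
  have : bclosure A (fun x => N * (2 * g x - 1)).
    apply: (bclosureZ algA); apply: (bclosureB algA); last exact: bclosure_cst.
    exact: bclosureZ.
  congr bclosure; apply/funext => x; rewrite /g; field; exact: lt0r_neq0.
pose u n x : R := n.+1%:R^-1 * \sum_(i < n.+1) (i.+1%:R <= n.+1%:R * g x)%R%:R.
have uE n x : u n x <= g x <= u n x + n.+1%:R^-1.
  have n0 : 0 < n.+1%:R :> R by rewrite ltr0n.
  have /andP[g0 g1] := g01 x.
  have := @floor_layers (n.+1%:R * g x) n.+1.
  rewrite mulr_ge0 ?ler0n// => /(_ isT) /=.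
  rewrite leNgt gtr_pMr// g1/= /u.
  set s : R := \sum_(i < _) _ => sE.
  by rewrite -{3}[n.+1%:R^-1]mulr1 -mulrDr ler_pdivrMl// ler_pdivlMl.
apply: (@bclosure_lim _ _ _ u 2).
- move=> n; apply: (bclosureZ algA).
  have clF i : bclosure A (fun x => (i.+1%:R <= n.+1%:R * g x)%R%:R).
    rewrite (_ : (fun x => _) = \1_[set x | i.+1%:R <= n.+1%:R * g x]).
      apply/mA/measurable_superlevel; apply: measurable_funM => //.
      apply: measurable_funM => //; apply: measurable_funD => //.
      exact: measurable_funM.
    apply/funext => x; rewrite indicE; congr (_%:R); congr nat_of_bool.
    by apply/idP/idP => [|/set_mem//]; exact: mem_set.
  exact: (bclosure_sum algA n.+1 clF).
- move=> n x; have /andP[h1 h2] := uE n x; have /andP[g0 g1] := g01 x.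
  have n1 : n.+1%:R^-1 <= 1 :> R by rewrite invf_le1 ?ler1n.
  rewrite ler_norml; move: (u n x) (g x) (n.+1%:R^-1 : R) h1 h2 g0 g1 n1 => *; lra.
- move=> x; apply: (@squeeze_cvgr _ _ _ _ (fun n => g x - n.+1%:R^-1) (fun=> g x)).
  + by near=> n; have /andP[h1 h2] := uE n x; rewrite h1 andbT lerBlDr.
  + rewrite -[X in _ --> X]subr0; apply: cvgB; first exact: cvg_cst.
    exact: cvg_harmonic.
  + exact: cvg_cst.
Unshelve. all: by end_near.
Qed.

End bclosure_measurable.

Lemma separable_dense_seq (T : ptopologicalType) : separable T ->
  exists e : nat -> T, forall U, open U -> U !=set0 -> exists n, U (e n).
Proof.
move=> [D cD dD].
have [x0 [_ Dx0]] : ([set: T] `&` D) !=set0.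
  by apply: dD; [exists point|exact: openT].
have [e eD] : exists e : nat -> T, D `<=` range e.
  have /countable_injP[g /in1TT _] := cD.
  have /countable_injP[h hinj] := cD.
  (* The sequence inverts the injection [h] of [D] into the naturals; [x0] fills the indices outside
     its image. *)
  pose e n := if pselect (exists2 x, D x & h x = n) is left p
    then sval (cid2 p) else x0.
  exists e => x Dx; exists (h x) => //; rewrite /e.
  case: pselect => [p|[]]; last by exists x.
  case: (cid2 p) => y Dy hy /=; apply: hinj => //; exact: mem_set.
exists e => U oU U0; have [x [Ux Dx]] := dD U U0 oU.
by have [n _ enx] := eD _ Dx; exists n; rewrite enx.
Qed.

(** * Trigonometric polynomials on a separable Hilbert space *)

Section borel_functions.
Context {R : realType}.

Lemma measurable_continuous_borel (T : ptopologicalType) (f : T -> R) :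
  continuous f -> measurable_fun [set: borel T] (f : borel T -> R).
Proof.
move=> /continuousP cf; apply: (measurability _ (RGenOpens.measurableE R)).
move=> _ [_ [a [b ->] <-]]; rewrite setTI; apply: sub_sigma_algebra.
exact/cf/interval_open.
Qed.

Lemma measurable_continuous_borel2 (T U : ptopologicalType) (f : T -> U) :
  continuous f -> measurable_fun [set: borel T] (f : borel T -> borel U).
Proof.
move=> /continuousP cf; apply: (@measurability _ _ (borel T) (borel U) setT f (@open U) erefl).
move=> _ [V oV <-]; rewrite setTI; apply: sub_sigma_algebra; exact: cf.
Qed.

End borel_functions.

Section hilbert.
Context {R : realType} {H : completeNormedModType R} (ip : {dot H for idfun}).
Implicit Types x y z : H.

Lemma ipDl x y z : ip (x + y) z = ip x z + ip y z.
Proof. exact: linearDl. Qed.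

Lemma ipDr x y z : ip x (y + z) = ip x y + ip x z.
Proof. exact: linearDr. Qed.

Lemma ipZl c x y : ip (c *: x) y = c * ip x y.
Proof. exact: linearZl_LR. Qed.

Lemma ipZr c x y : ip x (c *: y) = c * ip x y.
Proof. exact: linearZr_LR. Qed.

Lemma ipC x y : ip x y = ip y x.
Proof. by rewrite hermC expr0 mul1r. Qed.

Lemma ipNl x y : ip (- x) y = - ip x y.
Proof. by rewrite -scaleN1r ipZl mulN1r. Qed.

Lemma ipNr x y : ip x (- y) = - ip x y.
Proof. by rewrite ipC ipNl ipC. Qed.

Lemma ip0l y : ip 0 y = 0.
Proof. by rewrite -(scale0r 0) ipZl mul0r. Qed.

Hypothesis ip_norm : forall x, ip x x = `|x| ^+ 2.

Lemma ip_le_norm x y : ip x y <= `|x| * `|y|.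
Proof.
have := lerXn2r 2 (normr_ge0 (x + y)) (addr_ge0 (normr_ge0 x) (normr_ge0 y)) (ler_normD x y).
rewrite -ip_norm ipDl !ipDr !ip_norm (ipC y x).
by rewrite sqrrD; lra.
Qed.

Lemma ip_norm_le x y : `|ip x y| <= `|x| * `|y|.
Proof.
by rewrite ler_norml ip_le_norm andbT lerNl -ipNl -(normrN x) ip_le_norm.
Qed.

Lemma continuous_ip x : continuous (ip x).
Proof.
move=> y; apply/cvgrPdist_le => /= e e0; near=> z.
rewrite -ipNr -ipDr (le_trans (ip_norm_le _ _))//.
have k0 : 0 < `|x| + 1 by rewrite ltr_wpDl.
rewrite (@le_trans _ _ ((`|x| + 1) * `|y - z|))//.
  by rewrite ler_wpM2r// lerDl.
rewrite -ler_pdivlMl//; near: z; apply/nbhs_ballP.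
exists ((`|x| + 1)^-1 * e) => /= [|z]; first by rewrite mulr_gt0// invr_gt0.
by rewrite -ball_normE => /ltW.
Unshelve. all: by end_near.
Qed.

(** The phase replaces complex exponentials: [th = 0] is the cosine, [th = - pi / 2] the sine, and
    translations of [y] only change [th]. Hence the real span is stable under products and
    translations. *)
Definition tr x (th : R) : H -> R := fun y => cos (ip x y + th).

Inductive trig : (H -> R) -> Prop :=
| trig_tr x th : trig (tr x th)
| trigD f g : trig f -> trig g -> trig (fun y => f y + g y)
| trigZ c f : trig f -> trig (fun y => c * f y).

Lemma cosM (a b : R) : cos a * cos b = 2^-1 * cos (a + b) + 2^-1 * cos (a - b).
Proof. by rewrite cosD cosB; field. Qed.

Lemma trM x th x' th' : (fun y => tr x th y * tr x' th' y) =
  (fun y => 2^-1 * tr (x + x') (th + th') y + 2^-1 * tr (x - x') (th - th') y).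
Proof.
apply/funext => y; rewrite /tr cosM !ipDl ipNl.
by congr (_ * cos _ + _ * cos _); ring.
Qed.

Lemma trigM f g : trig f -> trig g -> trig (fun y => f y * g y).
Proof.
move=> tf tg; elim: tf => [x th|f1 f2 _ IH1 _ IH2|c f1 _ IH].
- elim: tg => [x' th'|g1 g2 _ IH1 _ IH2|c g1 _ IH].
  + by rewrite trM; apply: trigD; apply: trigZ; exact: trig_tr.
  + by under eq_fun do rewrite mulrDr; exact: trigD.
  + by under eq_fun do rewrite mulrCA; exact: trigZ.
- by under eq_fun do rewrite mulrDl; exact: trigD.
- by under eq_fun do rewrite -mulrA; exact: trigZ.
Qed.

Lemma trig_cst c : trig (fun=> c).
Proof.
have := trigZ c (trig_tr 0 0); congr trig; apply/funext => y.
by rewrite /tr ip0l addr0 cos0 mulr1.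
Qed.

Lemma trig_bounded f : trig f -> exists M, forall y, `|f y| <= M.
Proof.
elim=> [x th|g h _ [M gM] _ [N hN]|c g _ [M gM]].
- by exists 1 => y; exact: cos_max.
- by exists (M + N) => y; rewrite (le_trans (ler_normD _ _))// lerD.
- by exists (`|c| * M) => y; rewrite normrM ler_wpM2l.
Qed.

Lemma trig_algebra : bounded_algebra trig.
Proof.
split.
- exact: trig_bounded.
- exact: trig_cst.
- exact: trigD.
- exact: trigZ.
- exact: trigM.
Qed.

Lemma trig_shift f x : trig f -> trig (fun y => f (x + y)).
Proof.
elim=> [z th|g h _ IHg _ IHh|c g _ IH]; [|exact: trigD|exact: trigZ].
have := trig_tr z (ip z x + th); congr trig; apply/funext => y.
by rewrite /tr ipDr; congr cos; ring.
Qed.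

Lemma continuous_tr x th : continuous (tr x th).
Proof.
move=> y; apply: continuous_comp; last exact: continuous_cos.
by apply: cvgD; [exact: continuous_ip|exact: cvg_cst].
Qed.

Lemma trig_measurable f : trig f -> measurable_fun [set: borel H] (f : borel H -> R).
Proof.
elim=> [z th|g h _ IHg _ IHh|c g _ IH].
- by apply: measurable_continuous_borel; exact: continuous_tr.
- exact: measurable_funD.
- exact: measurable_funM.
Qed.

(** On []-pi, pi[] the sine has the sign of its argument. For fixed [y] the argument
    [(ip x y - c) / (n+1)] eventually lies there, so the sets where [u n] is positive converge to
    the half-space. *)
Lemma bclosure_halfspace x c : bclosure trig \1_[set y | c < ip x y].
Proof.
pose u n y := sin ((ip x y - c) / n.+1%:R).
have clu n : bclosure trig \1_[set y | 0 < u n y].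
  apply: (bclosure_gt trig_algebra); apply: bclosure_base.
  have := trig_tr (n.+1%:R^-1 *: x) (- c / n.+1%:R - pi / 2).
  congr trig; apply/funext => y; rewrite /tr /u ipZl addrA cosBpihalf.
  by congr sin; rewrite mulrBl mulNr mulrC.
apply: (bclosure_lim (M := 1) clu) => [n y|y].
  by rewrite indicE; case: (_ \in _); rewrite ?normr1 ?normr0.
apply: cvg_near_cst; near=> n.
have a_pi : `|ip x y - c| < pi * n.+1%:R.
  rewrite -ltr_pdivrMl ?pi_gt0// -natr1; apply: ltr_wpDr => //.
  near: n; exact: nbhs_infty_gtr.
have n0 : 0 < n.+1%:R :> R by rewrite ltr0n.
rewrite !indicE; congr (_%:R); congr nat_of_bool.
apply/idP/idP => /set_mem/= h; apply: mem_set => /=.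
  rewrite ltNge; apply/negP => xc; move: h; rewrite /u ltNge => /negP; apply.
  rewrite -oppr_ge0 -sinN; apply: sin_ge0_pi; rewrite -mulNr divr_ge0; [|lra|exact: ltW].
  rewrite ler_pdivrMr// (le_trans _ (ltW a_pi))// -normrN; exact: ler_norm.
apply: sin_gt0_pi; rewrite divr_gt0 ?subr_gt0//= ltr_pdivrMr//.
by rewrite (le_lt_trans (ler_norm _)).
Unshelve. all: by end_near.
Qed.

(** Cauchy-Schwarz gives one direction. For the other, [z = y] satisfies the open condition
    [r * |z| < ip y z], so some [e n] does. Complements of closed balls are thus countable unions of
    half-spaces. *)
Lemma norm_gt_halfspaces (e : nat -> H) (r : R) y :
  (forall U, open U -> U !=set0 -> exists n, U (e n)) -> 0 <= r ->
  r < `|y| <-> exists n, r * `|e n| < ip (e n) y.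
Proof.
move=> dense_e r0; split=> [ry|[n rn]]; last first.
  rewrite ltNge; apply/negP => yr; move: rn; rewrite ltNge => /negP; apply.
  by rewrite (le_trans (ip_le_norm _ _))// mulrC ler_wpM2r.
have y0 : 0 < `|y| by exact: le_lt_trans ry.
have [||n /= Un] := dense_e [set z | 0 < ip y z - r * `|z|].
- have /continuousP : continuous (fun z => ip y z - r * `|z|).
    move=> z; apply: cvgB; first exact: continuous_ip.
    by apply: cvgMr; exact: norm_continuous.
  move=> /(_ [set u | 0 < u] (@open_gt _ 0)); exact.
- exists y => /=; rewrite subr_gt0 ip_norm expr2 ltr_pM2r//.
by exists n; rewrite ipC -subr_gt0.
Qed.

Hypothesis H_separable : separable H.

Lemma bclosure_borel (B : set (borel H)) : measurable B -> bclosure trig \1_B.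
Proof.
have [e dense_e] := separable_dense_seq H_separable.
have [c0 cC cU] := sigma_algebra_bclosure_sets trig_algebra.
have cC' A : bclosure_sets trig A -> bclosure_sets trig (~` A).
  by move=> /cC; rewrite setTD.
have cball (z : H) (r : R) : 0 <= r ->
    bclosure_sets trig [set y | `|y - z| <= r].
  move=> r0; rewrite (_ : [set y | _] =
    ~` \bigcup_n [set y | r * `|e n| + ip (e n) z < ip (e n) y]).
    by apply/cC'/cU => n; exact: bclosure_halfspace.
  apply/seteqP; split => y /=.
    move=> + [n _ /= h]; rewrite leNgt => /negP; apply.
    apply/(norm_gt_halfspaces _ dense_e r0); exists n.
    by rewrite ipDr ipNr ltrBrDr.
  apply: contra_notP => /negP; rewrite -ltNge.
  move=> /(norm_gt_halfspaces _ dense_e r0)[n h]; exists n => //=.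
  by rewrite -ltrBrDr -ipNr -ipDr.
suff: <<s @open H >> `<=` bclosure_sets trig by exact.
apply: smallest_sub; first exact: (sigma_algebra_bclosure_sets trig_algebra).
move=> U oU.
(* An open set is the union of the closed balls with centers [e n] and radii [1/(k+1)] that it
   contains; pairs whose ball leaves [U] contribute the empty set. *)
pose F n k := if pselect ([set y | `|y - e n| <= k.+1%:R^-1] `<=` U) is left _
  then [set y | `|y - e n| <= k.+1%:R^-1] else set0.
rewrite (_ : U = \bigcup_n \bigcup_k F n k).
  apply: (cU) => n; apply: (cU) => k; rewrite /F; case: pselect => _ //.
  by apply: cball; rewrite invr_ge0.
apply/seteqP; split=> [y Uy|y [n _ [k _]]]; last first.
  by rewrite /F; case: pselect => // FU; exact: FU.
have /nbhs_ballP[r /= r0 rU] := open_nbhs_nbhs (conj oU Uy).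
have [k kr] : exists k, k.+1%:R^-1 < r / 2.
  have := @cvg_harmonic R; move/cvgrPdist_lt => /(_ (r / 2)).
  rewrite divr_gt0// => /(_ isT)[k _ /(_ k (leqnn k))] /=.
  by rewrite sub0r normrN ger0_norm ?invr_ge0//; exists k.
have [||n /= yn] := dense_e (ball y k.+1%:R^-1).
- exact: ball_open.
- by exists y; exact: ballxx.
exists n => //; exists k => //; rewrite /F; case: pselect => /= [_|[]].
  by move: yn; rewrite -ball_normE/= => /ltW.
move=> z /= zn; apply: rU; rewrite -ball_normE/=.
move: yn; rewrite -ball_normE/= => yn.
have h1 : `|y - e n| < r / 2 by exact: lt_trans yn kr.
have h2 : `|e n - z| < r / 2 by rewrite distrC (le_lt_trans zn).
by rewrite -(subrKA (e n)) (le_lt_trans (ler_normD _ _))// [ltRHS]splitr ltrD.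
Qed.

End hilbert.

(** * Expectations of functions of the process *)

Lemma dominated_cvg_Rintegral d (T : measurableType d) (R : realType)
    (mu : {measure set T -> \bar R}) (u : nat -> T -> R) (f g : T -> R) :
  (forall n, measurable_fun setT (u n)) ->
  (forall x, u ^~ x @ \oo --> f x) -> mu.-integrable setT (EFin \o g) ->
  (forall n x, `|u n x| <= g x) ->
  mu.-integrable setT (EFin \o f) /\
  \int[mu]_x u n x @[n --> \oo] --> \int[mu]_x f x.
Proof.
move=> mu_ uf ig ug.
have mf : measurable_fun setT f by exact: (measurable_fun_cvg mu_ (fun x _ => uf x)).
have [|||||i1 _ i2] := @dominated_convergence _ _ _ mu setT measurableT
  (fun n => EFin \o u n) (EFin \o f) (EFin \o g).
- by move=> n; exact/measurable_EFinP.
- exact/measurable_EFinP.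
- by apply/aeW => x _; apply: cvg_EFin => //; [exact: nearW|exact: uf].
- exact: ig.
- by apply/aeW => x n _ /=; rewrite lee_fin.
split => //; apply: fine_cvg; rewrite fineK//; exact: integrable_fin_num.
Qed.

Section bounded_borel.
Context {R : realType} {H : completeNormedModType R}.
Implicit Types f g : H -> R.

Lemma bounded_borelP f : bounded_borel f <->
  measurable_fun [set: borel H] (f : borel H -> R) /\
  exists M, forall x, `|f x| <= M.
Proof.
split=> -[mf]; last first.
  move=> [M fM]; split => //; exists M; split; first exact: num_real.
  by move=> N MN x _; exact: le_trans (ltW MN).
move=> [M [_ fM]]; split => //; exists (M + 1) => x.
by apply: (fM (M + 1)) => //; rewrite ltrDl.
Qed.

Lemma bounded_borel_trig (ip : {dot H for idfun}) f :
  (forall x, ip x x = `|x| ^+ 2) -> trig ip f -> bounded_borel f.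
Proof.
move=> ip_norm tf; apply/bounded_borelP; split; first exact: trig_measurable tf.
exact: trig_bounded tf.
Qed.

Lemma bounded_borel_cst c : bounded_borel (fun _ : H => c).
Proof. by apply/bounded_borelP; split => //; exists `|c|. Qed.

Lemma bounded_borelD f g : bounded_borel f -> bounded_borel g ->
  bounded_borel (fun x => f x + g x).
Proof.
move=> /bounded_borelP[mf [M fM]] /bounded_borelP[mg [N gN]].
apply/bounded_borelP; split; first exact: measurable_funD.
by exists (M + N) => x; rewrite (le_trans (ler_normD _ _))// lerD.
Qed.

Lemma bounded_borelM f g : bounded_borel f -> bounded_borel g ->
  bounded_borel (fun x => f x * g x).
Proof.
move=> /bounded_borelP[mf [M fM]] /bounded_borelP[mg [N gN]].
apply/bounded_borelP; split; first exact: measurable_funM.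
by exists (M * N) => x; rewrite normrM ler_pM.
Qed.

Lemma bounded_borelB f g : bounded_borel f -> bounded_borel g ->
  bounded_borel (fun x => f x - g x).
Proof.
move=> bf bg; have := bounded_borelD bf (bounded_borelM (bounded_borel_cst (-1)) bg).
by under eq_fun do rewrite mulN1r.
Qed.

Lemma bounded_borelX f n : bounded_borel f -> bounded_borel (fun x => f x ^+ n).
Proof.
move=> bf; elim: n => [|n IH]; first exact: bounded_borel_cst.
by under eq_fun do rewrite exprS; exact: bounded_borelM.
Qed.

Lemma bounded_borel_shift f x : bounded_borel f -> bounded_borel (fun y => f (x + y)).
Proof.
move=> /bounded_borelP[mf [M fM]]; apply/bounded_borelP; split; last by exists M.
apply: (measurableT_comp mf); apply: measurable_continuous_borel2 => y.
by apply: cvgD; [exact: cvg_cst|exact: cvg_id].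
Qed.

End bounded_borel.

Section expectation.
Context {R : realType} {H : completeNormedModType R}.
Context d (Omega : measurableType d) (P : probability Omega R).
Variable (L : R -> Omega -> H).
Hypothesis mL : forall t, 0 <= t -> measurable_fun [set: Omega] (L t : Omega -> borel H).
Implicit Types (f g h q : H -> R) (r s t : R).

Definition expect r h : R := \int[P]_w h (L r w).
Local Notation E := expect.

Lemma expect_integrable r h : 0 <= r -> bounded_borel h ->
  P.-integrable setT (EFin \o (fun w => h (L r w))).
Proof.
move=> r0 /bounded_borelP[mh [M hM]]; apply: measurable_bounded_integrable => //.
- by rewrite -ge0_fin_numE// fin_num_measure.
- exact: (measurableT_comp mh (mL r0)).
- by exists M; split; [exact: num_real|move=> N MN x _; exact: le_trans (ltW MN)].
Qed.

Lemma expectD r f g : 0 <= r -> bounded_borel f -> bounded_borel g ->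
  E r (fun y => f y + g y) = E r f + E r g.
Proof. by move=> r0 bf bg; rewrite /expect RintegralD//; exact: expect_integrable. Qed.

Lemma expectB r f g : 0 <= r -> bounded_borel f -> bounded_borel g ->
  E r (fun y => f y - g y) = E r f - E r g.
Proof. by move=> r0 bf bg; rewrite /expect RintegralB//; exact: expect_integrable. Qed.

Lemma expectZ r c f : 0 <= r -> bounded_borel f -> E r (fun y => c * f y) = c * E r f.
Proof. by move=> r0 bf; rewrite /expect RintegralZl//; exact: expect_integrable. Qed.

Lemma expect_cst r c : E r (fun=> c) = c.
Proof.
rewrite /expect Rintegral_cst// [X in fine X](_ : _ = 1%E) ?mulr1//.
exact: (probability_setT P).
Qed.

Lemma expect_ge0 r f : (forall y, 0 <= f y) -> 0 <= E r f.
Proof. by move=> f0; exact: Rintegral_ge0. Qed.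

Lemma expect_le r f g : 0 <= r -> bounded_borel f -> bounded_borel g ->
  (forall y, f y <= g y) -> E r f <= E r g.
Proof.
by move=> r0 bf bg fg; apply: le_Rintegral => //; exact: expect_integrable.
Qed.

Lemma expect_cvg r (u : nat -> H -> R) f M : 0 <= r ->
  (forall n, bounded_borel (u n)) -> (forall n x, `|u n x| <= M) ->
  (forall x, u ^~ x @ \oo --> f x) -> E r (u n) @[n --> \oo] --> E r f.
Proof.
move=> r0 bu uM uf.
have [] // := @dominated_cvg_Rintegral _ _ _ P (fun n w => u n (L r w))
  (fun w => f (L r w)) (fun=> M).
- move=> n; have /bounded_borelP[mu _] := bu n; exact: (measurableT_comp mu (mL r0)).
- exact: (expect_integrable r0 (bounded_borel_cst M)).
Qed.

Lemma transitionE t f x : transition P L t f x = E t (fun y => f (x + y)).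
Proof. by rewrite /transition unlock. Qed.

End expectation.

(** * The semigroup on trigonometric polynomials *)

Section semigroup.
Context {R : realType} {H : completeNormedModType R} (ip : {dot H for idfun}).
Hypothesis ip_norm : forall x, ip x x = `|x| ^+ 2.
Context d (Omega : measurableType d) (P : probability Omega R).
Variable L : R -> Omega -> H.
Hypothesis mL : forall t, 0 <= t -> measurable_fun [set: Omega] (L t : Omega -> borel H).
Variables a b : H -> R.
Local Notation E := (expect P L).
Local Notation tr := (tr ip).
Local Notation trig := (trig ip).
(** With exponent [a x + i b x], this is the real part of [e^(i th)] times the characteristic
    function [e^(- r (a x + i b x))] of [L r] at [x]. *)
Hypothesis expect_tr : forall x th r, 0 <= r ->
  E r (tr x th) = expR (- (r * a x)) * cos (th - r * b x).
Implicit Types (f g h q : H -> R) (r s t : R).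

Let bb := fun f => @bounded_borel_trig _ _ ip f ip_norm.

(* [wexpect r (fun=> 1)] is the transition operator [P_r]. *)
Definition wexpect s q f : H -> R := fun z => E s (fun y => f (z + y) * q y).
Local Notation W := wexpect.
Local Notation Pt r := (W r (fun=> 1)).

(** The addition formula separates [z] from [y]. Integrating in [y] against any weight therefore
    leaves a combination of [tr x 0] and [tr x (pi / 2)], which keeps trigonometric polynomials
    stable under [wexpect]. *)
Lemma tr_shift x th z y :
  tr x th (z + y) = tr x 0 z * tr x th y + tr x (pi / 2) z * tr x (th - pi / 2) y.
Proof.
rewrite /tr ipDr addr0 cosDpihalf addrA cosBpihalf mulNr -cosD.
by congr cos; ring.
Qed.

Lemma wexpect_tr s q x th z : 0 <= s -> bounded_borel q -> W s q (tr x th) z =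
  E s (fun y => tr x th y * q y) * tr x 0 z +
  E s (fun y => tr x (th - pi / 2) y * q y) * tr x (pi / 2) z.
Proof.
move=> s0 bq; rewrite /W.
under [X in E s X]eq_fun do rewrite tr_shift mulrDl -!mulrA.
have btr u : bounded_borel (tr x u) by apply: bb; exact: trig_tr.
have btrq u : bounded_borel (fun y => tr x u y * q y) by exact: bounded_borelM.
rewrite expectD//; last 2 first.
- by apply: bounded_borelM => //; exact: bounded_borel_cst.
- by apply: bounded_borelM => //; exact: bounded_borel_cst.
by rewrite !expectZ// mulrC [X in _ + X]mulrC.
Qed.

Lemma wexpectD s q f g : 0 <= s -> bounded_borel q -> trig f -> trig g ->
  W s q (fun y => f y + g y) = fun z => W s q f z + W s q g z.
Proof.
move=> s0 bq tf tg; apply/funext => z; rewrite /W.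
under [X in E s X]eq_fun do rewrite mulrDl.
by rewrite expectD//; apply: bounded_borelM => //; apply: bb; exact: trig_shift.
Qed.

Lemma wexpectZ s q c f : 0 <= s -> bounded_borel q -> trig f ->
  W s q (fun y => c * f y) = fun z => c * W s q f z.
Proof.
move=> s0 bq tf; apply/funext => z; rewrite /W.
under [X in E s X]eq_fun do rewrite -mulrA.
by rewrite expectZ//; apply: bounded_borelM => //; apply: bb; exact: trig_shift.
Qed.

Lemma trig_wexpect s q f : 0 <= s -> bounded_borel q -> trig f -> trig (W s q f).
Proof.
move=> s0 bq; elim=> [x th|g h tg IHg th IHh|c g tg IH].
- rewrite (funext (fun z => wexpect_tr x th z s0 bq)).
  by apply: trigD; apply: trigZ; exact: trig_tr.
- by rewrite wexpectD//; exact: trigD.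
- by rewrite wexpectZ//; exact: trigZ.
Qed.

Lemma wexpect1 r f z : W r (fun=> 1) f z = E r (fun y => f (z + y)).
Proof. by rewrite /W; under eq_fun do rewrite mulr1. Qed.

Lemma wexpect1_tr r x th : 0 <= r ->
  Pt r (tr x th) = fun z => expR (- (r * a x)) * tr x (th - r * b x) z.
Proof.
move=> r0; apply/funext => z; rewrite wexpect1.
rewrite (_ : (fun y => _) = tr x (ip x z + th)); last first.
  by apply/funext => y; rewrite /tr ipDr; congr cos; ring.
by rewrite expect_tr// /tr addrA.
Qed.

Lemma wexpect1_semigroup r s f : 0 <= r -> 0 <= s -> trig f ->
  Pt r (Pt s f) = Pt (r + s) f.
Proof.
move=> r0 s0; have rs0 := addr_ge0 r0 s0.
have b1 := bounded_borel_cst (1 : R) : bounded_borel (fun _ : H => 1).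
elim=> [x th|g h tg IHg th IHh|c g tg IH].
- rewrite !wexpect1_tr// wexpectZ//; last exact: trig_tr.
  rewrite wexpect1_tr//; apply/funext => z; rewrite mulrA -expRD.
  by congr (expR _ * tr _ _ _); ring.
- by rewrite !wexpectD ?IHg ?IHh//; exact: trig_wexpect.
- by rewrite !wexpectZ ?IH//; exact: trig_wexpect.
Qed.

(** Both operators are convolutions, the second one with a signed measure. At a fixed frequency [x]
    each acts on the span of cosine and sine by a scaled rotation, and plane rotations commute. *)
Lemma wexpect1_commute r s q f : 0 <= r -> 0 <= s -> bounded_borel q -> trig f ->
  Pt r (W s q f) = W s q (Pt r f).
Proof.
move=> r0 s0 bq; have b1 := bounded_borel_cst (1 : R) : bounded_borel (fun _ : H => 1).
elim=> [x th|g h tg IHg th IHh|c g tg IH].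
- rewrite wexpect1_tr// wexpectZ//; last exact: trig_tr.
  set al := E s (fun y => tr x th y * q y).
  set be := E s (fun y => tr x (th - pi / 2) y * q y).
  have trig2 u : trig (tr x u) by exact: trig_tr.
  rewrite (funext (fun z => wexpect_tr x th z s0 bq)) -/al -/be.
  rewrite wexpectD//; [|exact: trigZ..].
  rewrite !wexpectZ// !wexpect1_tr//; apply/funext => z.
  rewrite wexpect_tr//.
  have btrq u : bounded_borel (fun y => tr x u y * q y).
    by apply: bounded_borelM => //; exact: bb.
  (* All weighted expectations at frequency [x] are combinations of the two numbers [al] and [be],
     whatever the phase. *)
  have phase ph : E s (fun y => tr x (th - ph) y * q y) = cos ph * al + sin ph * be.
    rewrite /al /be -!expectZ// -expectD//; last 2 first.
    + by apply: bounded_borelM => //; exact: bounded_borel_cst.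
    + by apply: bounded_borelM => //; exact: bounded_borel_cst.
    congr expect; apply/funext => y; rewrite !mulrA -mulrDl; congr (_ * _).
    by rewrite /tr !addrA cosBpihalf cosB; ring.
  have -> : tr x (pi / 2 - r * b x) z = - sin (ip x z - r * b x).
    by rewrite /tr -cosDpihalf; congr cos; ring.
  rewrite -[th - _ - _]addrA -opprD !phase cosDpihalf sinDpihalf sub0r.
  by rewrite /tr addr0 cosDpihalf cosB sinB; ring.
- by rewrite !wexpectD ?IHg ?IHh//; exact: trig_wexpect.
- by rewrite !wexpectZ ?IH//; exact: trig_wexpect.
Qed.

Lemma wexpect1_0 f : trig f -> Pt 0 f = f.
Proof.
have b1 := bounded_borel_cst (1 : R) : bounded_borel (fun _ : H => 1).
elim=> [x th|g h tg IHg th IHh|c g tg IH].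
- rewrite wexpect1_tr//; apply/funext => z.
  by rewrite !mul0r oppr0 expR0 addr0 mul1r.
- by rewrite !wexpectD ?IHg ?IHh.
- by rewrite !wexpectZ ?IH.
Qed.

Lemma wexpect1_le r f g z : 0 <= r -> trig f -> trig g -> (forall y, f y <= g y) ->
  Pt r f z <= Pt r g z.
Proof.
move=> r0 tf tg fg; rewrite !wexpect1; apply: expect_le => //;
  by apply: bb; exact: trig_shift.
Qed.

(* E (G - E G - q)^2 >= 0 with G = f (z + L_s). *)
Lemma variance_ge_covariance s q f z : 0 <= s -> trig q -> trig f ->
  2 * (W s q f z - E s q * Pt s f z) - E s (fun y => q y ^+ 2) <=
  Pt s (fun y => f y ^+ 2) z - Pt s f z ^+ 2.
Proof.
move=> s0 tq tf; rewrite !wexpect1 /W.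
set G := fun y => f (z + y); set c := E s G.
have bq := bb tq; have bG : bounded_borel G by apply: bb; exact: trig_shift.
have bc (k : R) : bounded_borel (fun _ : H => k) by exact: bounded_borel_cst.
have : 0 <= E s (fun y => (G y - c - q y) ^+ 2).
  by apply: expect_ge0 => y; exact: sqr_ge0.
rewrite (_ : (fun y => _) = (fun y => (G y ^+ 2 + q y ^+ 2 + (-2) * (G y * q y))
  + ((c ^+ 2 + (-2 * c) * G y) + (2 * c) * q y))); last first.
  by apply/funext => y; ring.
have bGq := bounded_borelM bG bq.
have bG2 := bounded_borelX 2 bG.
have bq2 := bounded_borelX 2 bq.
have bZ k h : bounded_borel h -> bounded_borel (fun y => k * h y).
  by move=> bh; exact: bounded_borelM.
have b2 := bZ (-2) _ bGq; have b3 := bZ (-2 * c) _ bG; have b4 := bZ (2 * c) _ bq.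
have b12 := bounded_borelD bG2 bq2; have b34 := bounded_borelD (bc (c ^+ 2)) b3.
rewrite (expectD P mL s0 (bounded_borelD b12 b2) (bounded_borelD b34 b4)).
rewrite (expectD P mL s0 b12 b2) (expectD P mL s0 bG2 bq2).
rewrite (expectD P mL s0 b34 b4) (expectD P mL s0 (bc (c ^+ 2)) b3).
rewrite (expectZ P mL _ s0 bGq) (expectZ P mL _ s0 bG) (expectZ P mL _ s0 bq).
by rewrite expect_cst -/c; lra.
Qed.

(** This is [variance_ge_covariance] for [P_u f], integrated by [P_r] at the origin. Commutation and
    the semigroup law merge [r] and [u] on the left, so the lower bound depends on them only through
    [r + u]. *)
Lemma variance_step r s u q f : 0 <= r -> 0 <= s -> 0 <= u -> trig q -> trig f ->
  2 * (E s (fun y => Pt (r + u) f y * q y) - E s q * Pt (r + s + u) f 0)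
    - E s (fun y => q y ^+ 2) <=
  Pt (r + s) (fun y => Pt u f y ^+ 2) 0 - Pt r (fun y => Pt (s + u) f y ^+ 2) 0.
Proof.
move=> r0 s0 u0 tq tf.
have b1 := bounded_borel_cst (1 : R) : bounded_borel (fun _ : H => 1).
have trigB g h : trig g -> trig h -> trig (fun y => g y - h y).
  move=> tg th; have := trigD tg (trigZ (-1) th).
  by under eq_fun do rewrite mulN1r.
have trigX2 g : trig g -> trig (fun y => g y ^+ 2).
  by move=> tg; have := trigM tg tg; under eq_fun do rewrite -expr2.
have bq := bb tq.
pose g := Pt u f; have tg : trig g by exact: trig_wexpect.
pose lhs z := 2 * (W s q g z - E s q * Pt s g z) - E s (fun y => q y ^+ 2).
pose rhs z := Pt s (fun y => g y ^+ 2) z - Pt s g z ^+ 2.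
have t1 : trig (W s q g) by exact: trig_wexpect.
have t2 : trig (Pt s g) by exact: trig_wexpect.
have t3 : trig (Pt s (fun y => g y ^+ 2)) by apply: trig_wexpect => //; exact: trigX2.
have tl1 : trig (fun z => W s q g z - E s q * Pt s g z).
  by apply: trigB => //; exact: trigZ.
have tl : trig lhs.
  by apply: trigB; [exact: trigZ|exact: trig_cst].
have trr : trig rhs by apply: trigB => //; exact: trigX2.
have PB f1 f2 : trig f1 -> trig f2 ->
    Pt r (fun y => f1 y - f2 y) 0 = Pt r f1 0 - Pt r f2 0.
  move=> tf1 tf2; rewrite !wexpect1 expectB//; apply: bb; exact: trig_shift.
have Pcst c : Pt r (fun=> c) 0 = c by rewrite wexpect1 expect_cst.
have PZ k h : trig h -> Pt r (fun y => k * h y) 0 = k * Pt r h 0.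
  by move=> th; rewrite wexpectZ.
have := wexpect1_le 0 r0 tl trr (fun z => variance_ge_covariance z s0 tq tg).
have -> : Pt r lhs 0 = 2 * (Pt r (W s q g) 0 - E s q * Pt r (Pt s g) 0)
    - E s (fun y => q y ^+ 2).
  rewrite (PB _ _ (trigZ 2 tl1) (trig_cst ip _)) Pcst; congr (_ - _).
  by rewrite (PZ _ _ tl1) (PB _ _ t1 (trigZ _ t2)) (PZ _ _ t2).
have -> : Pt r rhs 0 = Pt r (Pt s (fun y => g y ^+ 2)) 0
    - Pt r (fun y => Pt s g y ^+ 2) 0 by exact: (PB _ _ t3 (trigX2 _ t2)).
rewrite (wexpect1_commute r0 s0 bq tg) (wexpect1_semigroup r0 s0 tg).
rewrite (wexpect1_semigroup r0 s0 (trigX2 _ tg)).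
rewrite (wexpect1_semigroup r0 u0 tf) (wexpect1_semigroup s0 u0 tf).
rewrite (wexpect1_semigroup (addr_ge0 r0 s0) u0 tf).
have -> // : W s q (Pt (r + u) f) 0 = E s (fun y => Pt (r + u) f y * q y).
by rewrite {1}/W; congr expect; apply/funext => y; rewrite add0r.
Qed.

Lemma variance_sum m s q f : 0 <= s -> trig q -> trig f ->
  m.+1%:R * (2 * (E s (fun y => Pt (m%:R * s) f y * q y)
    - E s q * Pt (m.+1%:R * s) f 0) - E s (fun y => q y ^+ 2)) <=
  E (m.+1%:R * s) (fun y => f y ^+ 2).
Proof.
move=> s0 tq tf; set c := (X in _ * X).
have b1 := bounded_borel_cst (1 : R) : bounded_borel (fun _ : H => 1).
(* Here [Phi] interpolates from [(P_t f 0)^2], bounded below by 0, to [P_t f^2] at 0, with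
   [t = (m+1) s]. Step [i] uses [r = i s] and [u = (m - i) s], so [r + u = m s] throughout and each
   increment is at least the same [c]. *)
pose Phi i := Pt (i%:R * s) (fun y => Pt ((m.+1 - i)%:R * s) f y ^+ 2) 0.
have Phi_ge i : (i <= m.+1)%N -> i%:R * c <= Phi i.
  elim: i => [_|i IH im].
    by rewrite mul0r /Phi wexpect1 expect_ge0// => y; exact: sqr_ge0.
  have h1 := IH (ltnW im).
  have := variance_step (mulr_ge0 (ler0n R i) s0) s0 (mulr_ge0 (ler0n R (m - i)) s0) tq tf.
  have -> : i%:R * s + (m - i)%:R * s = m%:R * s.
    by rewrite -mulrDl -natrD subnKC.
  have -> : i%:R * s + s + (m - i)%:R * s = m.+1%:R * s.
    by rewrite addrAC -mulrDl -natrD subnKC// -natr1 mulrDl mul1r.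
  have -> : s + (m - i)%:R * s = (m.+1 - i)%:R * s.
    by rewrite subSn// -natr1 mulrDl mul1r addrC.
  have -> : i%:R * s + s = i.+1%:R * s by rewrite -natr1 mulrDl mul1r.
  rewrite -/c => h2; have {}h2 : c <= Phi i.+1 - Phi i by exact: h2.
  move: (Phi i) (Phi i.+1) h1 h2 => X Y h1 h2.
  by rewrite -natr1 mulrDl mul1r (le_trans (lerD h1 h2))// addrC subrK.
have := Phi_ge _ (leqnn _); rewrite /Phi subnn mul0r wexpect1_0//.
by rewrite wexpect1; under [X in E _ X]eq_fun do rewrite add0r.
Qed.

End semigroup.

(** * Small-time asymptotics *)

Section complex_exponential.
Context {R : realType}.
Local Open Scope complex_scope.

Lemma cexp_imaginary (u : R) : cexp ('i%C * u%:C) = cos u +i* sin u.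
Proof.
by rewrite /cexp /=; simpc; rewrite expR0 !mul1r.
Qed.

Lemma cexp_opp_real_mul (t : R) (z : R[i]) : cexp (- (t%:C * z)) =
  (expR (- (t * complex.Re z)) * cos (t * complex.Im z)) +i*
  (- (expR (- (t * complex.Re z)) * sin (t * complex.Im z))).
Proof.
case: z => a b; rewrite /cexp /=; simpc.
by rewrite cosN sinN mulrN.
Qed.

End complex_exponential.

(** * Elementary bounds on sine and cosine, and difference quotients along [t / (m+1)] *)

Section real_inequalities.
Context {R : realType}.
Implicit Types u : R.

Lemma norm_sin_le u : `|sin u| <= `|u|.
Proof.
wlog u0 : u / 0 <= u.
  move=> h; have [/h//|/ltW u0] := leP 0 u.
  by rewrite -normrN -sinN -[leRHS]normrN h// oppr_ge0.
have [|c _] := @MVT_segment R sin cos 0 u u0.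
  by apply: continuous_subspaceT => x; exact: continuous_sin.
by rewrite sin0 !subr0 => ->; rewrite normrM ler_piMl// cos_max.
Qed.

Lemma norm_cosB1_le u : `|cos u - 1| <= u ^+ 2.
Proof.
wlog u0 : u / 0 <= u.
  move=> h; have [/h//|/ltW u0] := leP 0 u.
  by rewrite -cosN -sqrrN h// oppr_ge0.
have [|c cu] := @MVT_segment R cos (fun x => - sin x) 0 u u0.
  by apply: continuous_subspaceT => x; exact: continuous_cos.
rewrite cos0 !subr0 => ->; rewrite normrM normrN expr2.
rewrite (ger0_norm u0) ler_wpM2r// (le_trans (norm_sin_le _))//.
by move: cu; rewrite in_itv/= => /andP[c0 cu]; rewrite ger0_norm.
Qed.

(** Two applications of the mean value theorem. A quadratic bound suffices, because the compensated
    sine is only compared with [|y|^2] on the unit ball. *)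
Lemma norm_sinB_le u : `|sin u - u| <= u ^+ 2.
Proof.
wlog u0 : u / 0 <= u.
  move=> h; have [/h//|/ltW u0] := leP 0 u.
  by rewrite -normrN opprD -sinN -sqrrN h// oppr_ge0.
have [|c cu] := @MVT_segment R (fun x => sin x - x) (fun x => cos x - 1) 0 u u0.
  apply: continuous_subspaceT => x; apply: cvgB; [exact: continuous_sin|exact: cvg_id].
rewrite sin0 !subr0 => ->; rewrite normrM expr2 (ger0_norm u0) ler_wpM2r//.
have -> : cos c - 1 = cos c - cos 0 by rewrite cos0.
move: cu; rewrite in_itv/= => /andP[c0 cu].
have [|e eu] := @MVT_segment R cos (fun x => - sin x) 0 c c0.
  by apply: continuous_subspaceT => x; exact: continuous_cos.
rewrite subr0 => ->; rewrite normrM normrN (le_trans _ cu)//.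
by rewrite (ger0_norm c0) ler_piMl// sin_max.
Qed.

Lemma cvg_difference_quotient (f : R -> R) (df t : R) : 0 < t ->
  is_derive (0 : R) (1 : R) f df ->
  m.+1%:R * (f (t / m.+1%:R) - f 0) @[m --> \oo] --> t * df.
Proof.
move=> t0 [dv <-].
have h : (fun h => h^-1 *: ((f \o shift 0) (h *: 1) - f 0)) @ 0^' --> 'D_1 f 0 by exact: dv.
have c0 : t / m.+1%:R @[m --> \oo] --> 0.
  by rewrite -[X in _ --> X](mulr0 t); apply: cvgMr; exact: cvg_harmonic.
have st : (t / m.+1%:R @[m --> \oo]) --> 0^'.
  move=> A /= A0.
  have : \forall m \near \oo, t / m.+1%:R != 0 -> A (t / m.+1%:R) by exact: c0 _ A0.
  by apply: filterS => m; apply; rewrite gt_eqF ?divr_gt0.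
have h2 := cvg_comp _ _ st h.
rewrite (_ : (fun m => _) = fun m =>
    t * ((t / m.+1%:R)^-1 * ((f \o shift 0) ((t / m.+1%:R) *: 1) - f 0))).
  by apply: cvgMr; exact: h2.
apply/funext => m /=; rewrite addr0 scaler1 invf_div !mulrA; congr (_ * _).
by rewrite mulrAC divff ?mul1r ?gt_eqF.
Qed.

End real_inequalities.

(** * Lévy-Khintchine formula and small-time limits at the origin *)

Section generator.
Context {R : realType} {H : completeNormedModType R} (ip : {dot H for idfun}).
Hypothesis ip_norm : forall x, ip x x = `|x| ^+ 2.
Context d (Omega : measurableType d) (P : probability Omega R).
Variable L : R -> Omega -> H.
Hypothesis mL : forall t, 0 <= t -> measurable_fun [set: Omega] (L t : Omega -> borel H).
Variables (m : H) (Q : {linear H -> H}) (nu : {measure set (borel H) -> \bar R}).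
Hypothesis L_triplet : generating_triplet ip P L m Q nu.
Local Notation E := (expect P L).
Local Notation tr := (tr ip).
Local Notation trig := (trig ip).
Implicit Types (x y z : H) (f g h p q : H -> R) (r s t th : R).

Let bb := fun f => @bounded_borel_trig _ _ ip f ip_norm.

Definition decay x : R := complex.Re (levy_exponent ip m Q nu x).
Definition frequency x : R := complex.Im (levy_exponent ip m Q nu x).
Local Notation a := decay.
Local Notation b := frequency.

Lemma expect_tr x th r : 0 <= r ->
  E r (tr x th) = expR (- (r * a x)) * cos (th - r * b x).
Proof.
move=> r0; have [_ _ _ _ /(_ x r r0)] := L_triplet.
rewrite cexp_opp_real_mul /cintegral -/(a x) -/(b x).
under eq_Rintegral do rewrite cexp_imaginary /=.
under [X in (_ +i* X)%C = _]eq_Rintegral do rewrite cexp_imaginary /=.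
move=> [] Ec Es.
have bc u : bounded_borel (tr x u) by apply: bb; exact: trig_tr.
have -> : E r (tr x th) = cos th * E r (tr x 0) + sin th * E r (tr x (pi / 2)).
  rewrite -!expectZ// -expectD//; last 2 first.
  - by apply: bounded_borelM => //; exact: bounded_borel_cst.
  - by apply: bounded_borelM => //; exact: bounded_borel_cst.
  congr expect; apply/funext => y.
  by rewrite /tr addr0 cosDpihalf cosD; ring.
have -> : E r (tr x 0) = expR (- (r * a x)) * cos (r * b x).
  by rewrite -Ec; apply: eq_Rintegral => w _; rewrite /tr addr0.
have -> : E r (tr x (pi / 2)) = expR (- (r * a x)) * sin (r * b x).
  rewrite -[RHS]opprK -mulNr mulNr -Es -mulN1r -RintegralZl//.
    by apply: eq_Rintegral => w _; rewrite /tr cosDpihalf mulN1r.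
  have := expect_integrable P mL r0 (bc (- (pi / 2))).
  by under [X in _.-integrable _ X]eq_fun do rewrite /= /tr cosBpihalf.
by rewrite cosB; ring.
Qed.

Lemma measurable_norm_borel : measurable_fun [set: borel H] (fun y : borel H => `|y : H|).
Proof. apply: (@measurable_continuous_borel R H); exact: norm_continuous. Qed.

Lemma measurable_ip x : measurable_fun [set: borel H] (ip x : borel H -> R).
Proof. apply: (@measurable_continuous_borel R H); exact: continuous_ip. Qed.

Lemma integrable_min_norm2 :
  nu.-integrable setT (EFin \o (fun y : borel H => Num.min 1 (`|y : H| ^+ 2))).
Proof.
have [_ _ _ [_ fin_nu] _] := L_triplet.
apply/integrableP; split.
  apply/measurable_EFinP/measurable_minr => //.
  by apply: measurable_funX; exact: measurable_norm_borel.
under eq_integral => y _.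
  rewrite /= ger0_norm ?le_min ?ler01 ?exprn_ge0//.
  over.
exact: fin_nu.
Qed.

Lemma integrable_le_min_norm2 h C : measurable_fun [set: borel H] (h : borel H -> R) ->
  (forall y, `|h y| <= C * Num.min 1 (`|y| ^+ 2)) ->
  nu.-integrable setT (EFin \o (h : borel H -> R)).
Proof.
move=> mh hC.
have iC : nu.-integrable setT (EFin \o (fun y : borel H => C * Num.min 1 (`|y : H| ^+ 2))).
  exact: (integrableZl measurableT C integrable_min_norm2).
apply: (le_integrable measurableT _ _ iC) => [|y _ /=]; first exact/measurable_EFinP.
by rewrite lee_fin (le_trans (hC y))// ler_norm.
Qed.

Definition unit_ball : set (borel H) := [set z : H | `|z| <= 1].

(** Real part of the Lévy-Khintchine integrand; [sin_increment] is its compensated imaginary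
    part. *)
Definition cos_increment x y : R := cos (ip x y) - 1.

Definition sin_increment x y : R := sin (ip x y) - ip x y * \1_unit_ball y.

Lemma ip_sqr_le x y : ip x y ^+ 2 <= `|x| ^+ 2 * `|y| ^+ 2.
Proof.
rewrite -exprMn -real_normK ?num_real// lerXn2r ?nnegrE ?mulr_ge0//.
exact: ip_norm_le.
Qed.

Lemma integrable_cos_increment x :
  nu.-integrable setT (EFin \o (cos_increment x : borel H -> R)).
Proof.
(* The summand 2 covers the points where the minimum is 1, and [|x|^2] covers those where it is
   [|y|^2]. *)
apply: (@integrable_le_min_norm2 _ (`|x| ^+ 2 + 2)).
  apply: measurable_funB => //.
  exact: (measurableT_comp (continuous_measurable_fun (@continuous_cos R)) (measurable_ip x)).
move=> y; have x0 : 0 <= `|x| ^+ 2 by exact: exprn_ge0.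
rewrite minEle; case: ifPn => [_|_]; rewrite ?mulr1.
  rewrite (le_trans (ler_normB _ _))// normr1.
  by have := cos_max (ip x y); lra.
rewrite (le_trans (norm_cosB1_le _))// (le_trans (ip_sqr_le _ _))//.
by rewrite ler_wpM2r ?exprn_ge0//; lra.
Qed.

Lemma integrable_sin_increment x :
  nu.-integrable setT (EFin \o (sin_increment x : borel H -> R)).
Proof.
apply: (@integrable_le_min_norm2 _ (`|x| ^+ 2 + 2)).
  apply: measurable_funB.
    exact: (measurableT_comp (continuous_measurable_fun (@continuous_sin R))
      (measurable_ip x)).
  apply: measurable_funM; first exact: measurable_ip.
  apply: measurable_indic; rewrite (_ : unit_ball = [set y | 0 <= 1 - `|y : H|]).
    apply: measurable_superlevel.
    by apply: measurable_funB => //; exact: measurable_norm_borel.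
  by apply/seteqP; split => y; rewrite /unit_ball/= subr_ge0.
move=> y; have x0 : 0 <= `|x| ^+ 2 by exact: exprn_ge0.
rewrite /sin_increment indicE; have [y1|y1] := leP `|y| 1.
  rewrite mem_set// mulr1 min_r ?exprn_ile1//.
  rewrite (le_trans (norm_sinB_le _))// (le_trans (ip_sqr_le _ _))//.
  by rewrite ler_wpM2r ?exprn_ge0//; lra.
rewrite memNset; last by apply/negP; rewrite -ltNge.
rewrite mulr0 subr0 min_l; last by rewrite exprn_ege1// ltW.
by have := sin_max (ip x y); lra.
Qed.

Lemma decayE x : a x = ip (Q x) x / 2 - \int[nu]_y cos_increment x y.
Proof.
rewrite /decay /levy_exponent /cintegral /=; congr (_ - _); first by ring.
apply: eq_Rintegral => y _; rewrite /cos_increment.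
by rewrite !mul0r !mulr0 !mul1r !subr0 !add0r expR0 mul1r.
Qed.

Lemma frequencyE x : b x = - ip x m - \int[nu]_y sin_increment x y.
Proof.
rewrite /frequency /levy_exponent /cintegral /=; congr (_ - _); first by ring.
apply: eq_Rintegral => y _; rewrite /sin_increment.
by rewrite !mul0r !mulr0 !mul1r !subr0 !add0r expR0 mul1r addr0.
Qed.

Variable t : R.
Hypothesis t_gt0 : 0 < t.
Local Notation dt k := (t / k.+1%:R).

Let dt_ge0 k : 0 <= dt k.
Proof. by rewrite divr_ge0// ltW. Qed.

(* The generator at [0] maps [p] to [l + \int h dnu]; the compensator contained in
   [h] and the drift and Gaussian contributions collected in [l] cancel as soon as
   [p] vanishes to third order at [0]. *)
Definition has_generator p h l :=
  [/\ trig p, nu.-integrable setT (EFin \o (h : borel H -> R)) &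
  k.+1%:R * (E (dt k) p - p 0) @[k --> \oo] --> t * (l + \int[nu]_y h y)].

Lemma has_generatorD p p' h h' l l' : has_generator p h l -> has_generator p' h' l' ->
  has_generator (fun y => p y + p' y) (fun y => h y + h' y) (l + l').
Proof.
move=> [tp ih lim] [tp' ih' lim']; split; first exact: trigD.
  exact: (integrableD measurableT ih ih').
rewrite RintegralD// addrACA mulrDr.
rewrite (_ : (fun k => _) = fun k => k.+1%:R * (E (dt k) p - p 0)
    + k.+1%:R * (E (dt k) p' - p' 0)); first exact: cvgD.
by apply/funext => k; rewrite expectD//; [ring|exact: bb..].
Qed.

Lemma has_generatorZ c p h l : has_generator p h l ->
  has_generator (fun y => c * p y) (fun y => c * h y) (c * l).
Proof.
move=> [tp ih lim]; split; first exact: trigZ.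
  exact: (integrableZl measurableT c ih).
rewrite RintegralZl// -mulrDr mulrCA.
rewrite (_ : (fun k => _) = fun k => c * (k.+1%:R * (E (dt k) p - p 0))).
  exact: cvgMr.
by apply/funext => k; rewrite expectZ//; [ring|exact: bb].
Qed.

(** The limit is [t] times the derivative at [s = 0] of [exp (- s a) * cos (th - s b)], namely
    [- a cos th + b sin th]. Inserting [decayE] and [frequencyE] separates the diffusion and drift
    terms from the integral. *)
Lemma has_generator_tr x th : has_generator (tr x th)
  (fun y => cos th * cos_increment x y + (- sin th) * sin_increment x y)
  (- (ip (Q x) x / 2 * cos th) - ip x m * sin th).
Proof.
have ic := integrableZl measurableT (cos th) (integrable_cos_increment x).
have isn := integrableZl measurableT (- sin th) (integrable_sin_increment x).
split; [exact: trig_tr|exact: (integrableD measurableT ic isn)|].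
pose F (s : R) := expR (- (s * a x)) * cos (th - s * b x).
have dF : is_derive (0 : R) (1 : R) F (- a x * cos th + b x * sin th).
  have dl (c k : R) : is_derive (0 : R) (1 : R) (fun s => c - s * k) (- k).
    rewrite (_ : (fun s => _) = cst c - (k *: @id R)); last first.
      by apply/funext => s /=; rewrite mulrC.
    by apply: is_derive_eq; rewrite sub0r scaler1.
  have dcos : is_derive (0 : R) (1 : R) (cos \o (fun s => th - s * b x))
      (- sin (th - 0 * b x) * - b x).
    by apply: is_derive1_comp.
  have dexp : is_derive (0 : R) (1 : R) (expR \o (fun s => 0 - s * a x))
      (expR (0 - 0 * a x) * - a x).
    by apply: is_derive1_comp.
  have := is_deriveM dexp dcos.
  rewrite (_ : _ * _ = F); last first.
    apply/funext => s; rewrite /F -[- (s * a x)]sub0r; exact: erefl.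
  move=> dF; apply: is_derive_eq.
  by rewrite /= !mul0r !subr0 expR0 /GRing.scale /=; ring.
rewrite RintegralD// !RintegralZl//;
  [|exact: integrable_sin_increment|exact: integrable_cos_increment].
rewrite (_ : _ + _ = - a x * cos th + b x * sin th); last first.
  by rewrite decayE frequencyE; ring.
rewrite (_ : (fun k => _) = fun k => k.+1%:R * (F (dt k) - F 0)).
  exact: cvg_difference_quotient.
apply/funext => k; rewrite expect_tr// /F !mul0r oppr0 expR0 addr0 mul1r.
by rewrite /tr (ipC _ x) ip0l add0r.
Qed.

Definition has_jump_limit q :=
  [/\ trig q, nu.-integrable setT (EFin \o (q : borel H -> R)) &
  k.+1%:R * E (dt k) q @[k --> \oo] --> t * \int[nu]_y q y].

Lemma has_jump_limitD p q : has_jump_limit p -> has_jump_limit q ->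
  has_jump_limit (fun y => p y + q y).
Proof.
move=> [tp ip' lim] [tq iq lim']; split; first exact: trigD.
  exact: (integrableD measurableT ip' iq).
rewrite RintegralD// mulrDr.
rewrite (_ : (fun k => _) = fun k => k.+1%:R * E (dt k) p + k.+1%:R * E (dt k) q).
  exact: cvgD.
by apply/funext => k; rewrite expectD//; [ring|exact: bb..].
Qed.

Lemma has_jump_limitZ c q : has_jump_limit q -> has_jump_limit (fun y => c * q y).
Proof.
move=> [tq iq lim]; split; first exact: trigZ.
  exact: (integrableZl measurableT c iq).
rewrite RintegralZl// mulrCA.
rewrite (_ : (fun k => _) = fun k => c * (k.+1%:R * E (dt k) q)).
  exact: cvgMr.
by apply/funext => k; rewrite expectZ//; [ring|exact: bb].
Qed.

(** The square matters: [1 - cos (ip z y)] vanishes only to second order at 0, and its generator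
    would retain the Gaussian term [ip (Q z) z / 2]. *)
Definition cos_bump z y : R := (1 - cos (ip z y)) ^+ 2.

(* [cos_bump z * tr x th] is a quarter of the fourth difference of [tr _ th] in
   direction [z] at [x]. *)
Lemma has_jump_limit_cos_bump_tr z x th : has_jump_limit (fun y => cos_bump z y * tr x th y).
Proof.
(* The coefficients come from [(1 - cos v)^2 = 3/2 - 2 cos v + cos (2 v) / 2]; multiplying by
   [cos (u + th)] splits the last two terms evenly between the frequencies [x + z], [x - z] and
   [x + 2 z], [x - 2 z]. *)
have g0 := has_generatorZ (3 / 2) (has_generator_tr x th).
have g1 := has_generatorZ (-1) (has_generator_tr (x + z) th).
have g2 := has_generatorZ (-1) (has_generator_tr (x - z) th).
have g3 := has_generatorZ (4^-1) (has_generator_tr (x + (z + z)) th).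
have g4 := has_generatorZ (4^-1) (has_generator_tr (x - (z + z)) th).
have := has_generatorD g0 (has_generatorD g1 (has_generatorD g2 (has_generatorD g3 g4))).
set p := (X in has_generator X _ _); set h := (X in has_generator _ X _).
set l := (X in has_generator _ _ X).
have pE : p = fun y => cos_bump z y * tr x th y.
  apply/funext => y; rewrite /p /cos_bump /tr !ipDl !ipNl !ipDl.
  have : cos (ip z y + ip z y) = 2 * cos (ip z y) ^+ 2 - 1.
    by rewrite -mulr2n cos_mulr2n; ring.
  move: (ip x y) (ip z y) => u v; move: (v + v) => w cw.
  by rewrite !(cosD, sinD, cosN, sinN) cw; field.
(* The coefficients sum to 0 and their first moment in [z] vanishes, so the constants -1 and the
   linear compensators cancel and the integrand is [p] itself. *)
have hE : h = p.
  apply/funext => y; rewrite /h /p /tr /cos_increment /sin_increment.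
  rewrite !(cosD _ th) !ipDl !ipNl !ipDl.
  move: (ip x y) (ip z y) (\1_unit_ball y) => u v e.
  move: (cos _) (cos _) (cos _) (cos _) (sin _) (sin _) (sin _) (sin _) => *.
  by field.
(* The second moment also vanishes: [ip (Q z) z] occurs with total coefficient proportional to
   [- 2 + 2 * 4 / 4 = 0], and the cross terms cancel by the symmetry in [z]. *)
have l0 : l = 0.
  have QN u : Q (- u) = - Q u by exact: raddfN.
  have QD u v : Q (u + v) = Q u + Q v by exact: raddfD.
  rewrite /l !(QD, QN, ipDl, ipDr, ipNl, ipNr).
  by field.
rewrite l0 hE pE => -[tp ih lim]; split => //.
move: lim; rewrite add0r (_ : cos_bump z 0 * tr x th 0 = 0).
  by under eq_fun do rewrite subr0.
by rewrite /cos_bump (ipC _ z) ip0l cos0 subrr expr0n mul0r.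
Qed.

Lemma has_jump_limit_cos_bump z f : trig f -> has_jump_limit (fun y => cos_bump z y * f y).
Proof.
elim=> [x th|g h tg IHg th IHh|c g tg IH].
- exact: has_jump_limit_cos_bump_tr.
- by under eq_fun do rewrite mulrDr; exact: has_jump_limitD.
- by under eq_fun do rewrite mulrCA; exact: has_jump_limitZ.
Qed.

Lemma trig_cos_bump z : trig (cos_bump z).
Proof.
have tB : trig (fun y => 1 - cos (ip z y)).
  have := trigD (trig_cst ip 1) (trigZ (-1) (trig_tr ip z 0)).
  congr trig; apply/funext => y; by rewrite /tr addr0 mulN1r.
by have := trigM tB tB; congr trig; apply/funext => y; rewrite /cos_bump expr2.
Qed.

(** The function tested against the law of [L (dt k)] itself varies with [k]. At one frequency,
    however, the elapsed time [k dt = t - t / (k+1)] occurs only in scalar coefficients of the two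
    fixed functions [tr x 0] and [tr x (pi / 2)], so coefficients and expectations converge
    separately. *)
Lemma has_jump_limit_cvg f q : trig f -> bounded_borel q ->
  (forall g, trig g -> has_jump_limit (fun y => g y * q y)) ->
  k.+1%:R * E (dt k) (fun y => wexpect P L (k%:R * dt k) (fun=> 1) f y * q y)
    @[k --> \oo] --> t * \int[nu]_y (wexpect P L t (fun=> 1) f y * q y).
Proof.
move=> tf bq jq.
have t0 := ltW t_gt0.
have b1 := bounded_borel_cst (1 : R) : bounded_borel (fun _ : H => 1).
have kdt0 k : 0 <= k%:R * dt k by exact: mulr_ge0.
have btq r g : 0 <= r -> trig g ->
    bounded_borel (fun y => wexpect P L r (fun=> 1) g y * q y).
  by move=> r0 tg; apply: bounded_borelM => //; apply: bb; exact: trig_wexpect.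
have itq r g : 0 <= r -> trig g ->
    nu.-integrable setT (EFin \o (fun y : borel H => wexpect P L r (fun=> 1) g y * q y)).
  move=> r0 tg; have [] := jq (wexpect P L r (fun=> 1) g) => //; exact: trig_wexpect.
elim: tf => [x th|g h tg IHg th IHh|c g tg IH].
- have tE r : 0 <= r -> (fun y => wexpect P L r (fun=> 1) (tr x th) y * q y) = fun y =>
      expR (- (r * a x)) * (cos (th - r * b x) * (tr x 0 y * q y) +
      sin (th - r * b x) * (tr x (pi / 2) y * q y)).
    move=> r0; apply/funext => y; rewrite (wexpect1_tr expect_tr)//.
    by rewrite /tr addr0 cosDpihalf [cos (ip x y + _)]cosD; ring.
  have [tq1 iq1 l1] := jq _ (trig_tr ip x 0).
  have [tq2 iq2 l2] := jq _ (trig_tr ip x (pi / 2)).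
  set I1 := \int[nu]_y (tr x 0 y * q y) in l1.
  set I2 := \int[nu]_y (tr x (pi / 2) y * q y) in l2.
  pose G r A B := expR (- (r * a x)) * (cos (th - r * b x) * A + sin (th - r * b x) * B).
  rewrite (_ : (fun k => _) = fun k => G (k%:R * dt k)
      (k.+1%:R * E (dt k) (fun y => tr x 0 y * q y))
      (k.+1%:R * E (dt k) (fun y => tr x (pi / 2) y * q y))); last first.
    apply/funext => k; rewrite tE// expectZ//; last first.
      by apply: bounded_borelD; apply: bounded_borelM;
        do ?[exact: bounded_borel_cst|exact: bb].
    rewrite expectD//; [|by apply: bounded_borelM; [exact: bounded_borel_cst|exact: bb]..].
    by rewrite !expectZ//; [rewrite /G; ring|exact: bb..].
  have -> : \int[nu]_y (wexpect P L t (fun=> 1) (tr x th) y * q y) = G t I1 I2.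
    transitivity (\int[nu]_y (expR (- (t * a x)) * (cos (th - t * b x) * (tr x 0 y * q y) +
        sin (th - t * b x) * (tr x (pi / 2) y * q y)))).
      by apply: eq_Rintegral => y _; exact: (congr1 (@^~ y) (tE t t0)).
    have iZ1 := integrableZl measurableT (cos (th - t * b x)) iq1.
    have iZ2 := integrableZl measurableT (sin (th - t * b x)) iq2.
    rewrite RintegralZl//; last exact: (integrableD measurableT iZ1 iZ2).
    by rewrite RintegralD// !RintegralZl.
  rewrite (_ : t * _ = G t (t * I1) (t * I2)); last by rewrite /G; ring.
  have kdt : k%:R * dt k @[k --> \oo] --> t.
    rewrite (_ : (fun k => _) = fun k => t - t * k.+1%:R^-1); last first.
      by apply/funext => k; rewrite -[k.+1%:R]natr1; field; rewrite natr1 pnatr_eq0.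
    rewrite -[X in _ --> X]subr0; apply: cvgB; first exact: cvg_cst.
    by rewrite -[X in _ --> X](mulr0 t); apply: cvgMr; exact: cvg_harmonic.
  have phase : th - k%:R * dt k * b x @[k --> \oo] --> th - t * b x.
    by apply: cvgB; [exact: cvg_cst|exact: cvgMl].
  have edt : - (k%:R * dt k * a x) @[k --> \oo] --> - (t * a x).
    by apply: cvgN; exact: cvgMl.
  apply: cvgM; first exact: (cvg_comp _ _ edt (@continuous_expR R _)).
  apply: cvgD; apply: cvgM => //.
    exact: (cvg_comp _ _ phase (@continuous_cos R _)).
  exact: (cvg_comp _ _ phase (@continuous_sin R _)).
- have WE r : 0 <= r ->
      (fun y => wexpect P L r (fun=> 1) (fun y => g y + h y) y * q y) =
      fun y => wexpect P L r (fun=> 1) g y * q y + wexpect P L r (fun=> 1) h y * q y.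
    by move=> r0; apply/funext => y; rewrite (wexpectD ip_norm P mL)// mulrDl.
  rewrite (_ : (fun k => _) = fun k =>
      k.+1%:R * E (dt k) (fun y => wexpect P L (k%:R * dt k) (fun=> 1) g y * q y) +
      k.+1%:R * E (dt k) (fun y => wexpect P L (k%:R * dt k) (fun=> 1) h y * q y));
      last first.
    apply/funext => k; rewrite (WE _ (kdt0 k)) -mulrDr.
    by rewrite (expectD P mL (dt_ge0 k) (btq _ _ (kdt0 k) tg) (btq _ _ (kdt0 k) th)).
  rewrite (_ : \int[nu]_y _ = \int[nu]_y (wexpect P L t (fun=> 1) g y * q y) +
      \int[nu]_y (wexpect P L t (fun=> 1) h y * q y)); last first.
    rewrite -RintegralD//; [|exact: itq..].
    by apply: eq_Rintegral => y _; exact: (congr1 (@^~ y) (WE t t0)).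
  by rewrite [t * _]mulrDr; exact: (cvgD IHg IHh).
- have WE r : 0 <= r ->
      (fun y => wexpect P L r (fun=> 1) (fun y => c * g y) y * q y) =
      fun y => c * (wexpect P L r (fun=> 1) g y * q y).
    by move=> r0; apply/funext => y; rewrite (wexpectZ ip_norm P mL)// mulrA.
  rewrite (_ : (fun k => _) = fun k =>
      c * (k.+1%:R * E (dt k) (fun y => wexpect P L (k%:R * dt k) (fun=> 1) g y * q y)));
      last first.
    apply/funext => k; rewrite (WE _ (kdt0 k)) [RHS]mulrCA; congr (_ * _).
    exact: (expectZ P mL c (dt_ge0 k) (btq _ _ (kdt0 k) tg)).
  rewrite (_ : \int[nu]_y _ = c * \int[nu]_y (wexpect P L t (fun=> 1) g y * q y));
    last first.
    rewrite -RintegralZl//; last exact: itq.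
    by apply: eq_Rintegral => y _; exact: (congr1 (@^~ y) (WE t t0)).
  by rewrite [t * _]mulrCA; exact: (cvgMr IH).
Qed.

Lemma trig_gradient_bound f q : trig f -> trig q ->
  has_jump_limit q -> has_jump_limit (fun y => q y ^+ 2) ->
  (forall g, trig g -> has_jump_limit (fun y => g y * q y)) ->
  t * (2 * (\int[nu]_y (wexpect P L t (fun=> 1) f y * q y)
      - wexpect P L t (fun=> 1) f 0 * \int[nu]_y q y) - \int[nu]_y (q y ^+ 2)) <=
  E t (fun y => f y ^+ 2).
Proof.
move=> tf tq [_ _ lq] [_ _ lq2] jq.
have lfq := has_jump_limit_cvg tf (bb tq) jq.
set c := wexpect P L t (fun=> 1) f 0.
set I := \int[nu]_y (_ * _) in lfq *.
have lim : k.+1%:R * (2 * (E (dt k)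
      (fun y => wexpect P L (k%:R * dt k) (fun=> 1) f y * q y)
    - E (dt k) q * c) - E (dt k) (fun y => q y ^+ 2)) @[k --> \oo] -->
    2 * (t * I - (t * \int[nu]_y q y) * c) - t * \int[nu]_y (q y ^+ 2).
  rewrite (_ : (fun k => _) = fun k =>
    2 * (k.+1%:R * E (dt k) (fun y => wexpect P L (k%:R * dt k) (fun=> 1) f y * q y)
      - (k.+1%:R * E (dt k) q) * c) - k.+1%:R * E (dt k) (fun y => q y ^+ 2)).
    apply: cvgB lq2; apply: cvgMr; apply: cvgB => //; exact: cvgMl.
  by apply/funext => k; ring.
rewrite (_ : t * _ = 2 * (t * I - (t * \int[nu]_y q y) * c) - t * \int[nu]_y (q y ^+ 2));
  last by ring.
rewrite -(cvg_lim _ lim)//; apply: limr_le; first exact: cvgP lim.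
apply: nearW => k.
have := variance_sum ip_norm mL expect_tr k (dt_ge0 k) tq tf.
by rewrite [k.+1%:R * dt k]mulrC divfK ?pnatr_eq0.
Qed.

End generator.

(** * Extension to bounded Borel functions *)

Section gradient_bound.
Context {R : realType} {H : completeNormedModType R} (ip : {dot H for idfun}).
Hypothesis ip_norm : forall x, ip x x = `|x| ^+ 2.
Hypothesis H_separable : separable H.
Context d (Omega : measurableType d) (P : probability Omega R).
Variable L : R -> Omega -> H.
Hypothesis mL : forall t, 0 <= t -> measurable_fun [set: Omega] (L t : Omega -> borel H).
Variables (m : H) (Q : {linear H -> H}) (nu : {measure set (borel H) -> \bar R}).
Hypothesis L_triplet : generating_triplet ip P L m Q nu.
Variable t : R.
Hypothesis t_gt0 : 0 < t.
Local Notation E := (expect P L).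
Local Notation trig := (trig ip).
Local Notation T := (wexpect P L t (fun=> 1)).
Implicit Types (x y z : H) (f g h p q : H -> R).

Let t_ge0 : 0 <= t := ltW t_gt0.

Let bb := fun f => @bounded_borel_trig _ _ ip f ip_norm.

Lemma bounded_borel_bclosure f : bounded_borel f <-> bclosure trig f.
Proof.
split=> [/bounded_borelP[mf fM]|clf].
  apply: (@bclosure_of_measurable R _ (borel H)) => //.
    exact: trig_algebra.
  exact: bclosure_borel.
apply/bounded_borelP; split; last exact: bclosure_bounded (trig_algebra ip) _ clf.
apply: (@measurable_bclosure R _ (borel H) trig) => // g tg.
exact: trig_measurable tg.
Qed.

Lemma expect_norm_le h M : bounded_borel h -> (forall y, `|h y| <= M) -> `|E t h| <= M.
Proof.
move=> bh hM; rewrite ler_norml -[X in X <= _ <= _](expect_cst P L t).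
rewrite -[X in _ <= _ <= X](expect_cst P L t).
by apply/andP; split; apply: expect_le => //; try exact: bounded_borel_cst;
  move=> y; have := hM y; rewrite ler_norml => /andP[].
Qed.

Lemma wexpect1_norm_le f M : bounded_borel f -> (forall y, `|f y| <= M) ->
  forall y, `|T f y| <= M.
Proof.
move=> bf fM y; rewrite wexpect1; apply: expect_norm_le => //.
exact: bounded_borel_shift.
Qed.

Lemma wexpect1_cvg (u : nat -> H -> R) f M : (forall n, bounded_borel (u n)) ->
  (forall n x, `|u n x| <= M) -> (forall x, u ^~ x @ \oo --> f x) ->
  forall y, T (u n) y @[n --> \oo] --> T f y.
Proof.
move=> bu uM uf y; rewrite wexpect1; under eq_fun do rewrite wexpect1.
apply: (@expect_cvg _ _ _ _ P L mL t (fun n z => u n (y + z))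
  (fun z => f (y + z)) M) => // n; exact: bounded_borel_shift.
Qed.

(** Measurability follows from the closure: [T] maps trigonometric polynomials to trigonometric
    polynomials and respects bounded pointwise limits. *)
Lemma bounded_borel_wexpect1 f : bounded_borel f -> bounded_borel (T f).
Proof.
move=> bf; apply/bounded_borelP; split; last first.
  have /bounded_borelP[_ [M fM]] := bf.
  by exists M; exact: wexpect1_norm_le.
move/bounded_borel_bclosure : bf; elim=> [g tg|u M g clu IH uM ug].
  apply: (@trig_measurable R H ip ip_norm); apply: trig_wexpect => //.
  exact: bounded_borel_cst.
apply: (measurable_fun_cvg IH) => y _; apply: wexpect1_cvg uM ug y => n.
exact/bounded_borel_bclosure.
Qed.

Definition increment f y := T f y - T f 0.

Lemma bounded_borel_increment f : bounded_borel f -> bounded_borel (increment f).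
Proof.
move=> /bounded_borel_wexpect1 bT; apply: bounded_borelB => //.
exact: bounded_borel_cst.
Qed.

(** * Test functions [rho * p] with a fixed integrable weight [rho] *)

Section weight.
Variable rho : H -> R.
Hypothesis trig_rho : trig rho.
Hypothesis rho_jump : forall g, trig g ->
  has_jump_limit ip P L nu t (fun y => rho y * g y).

Let integrable_rho : nu.-integrable setT (EFin \o (rho : borel H -> R)).
Proof.
have [_ + _] := rho_jump (trig_cst ip 1).
by under [X in _.-integrable _ (_ \o X)]eq_fun do rewrite mulr1.
Qed.

(** This is [2 g q - q^2] with [g] the increment of [T f] and [q = rho * p], factored so that the
    bound by a multiple of [|rho|] is apparent. *)
Definition integrand f p y : R :=
  (2 * increment f y - rho y * p y) * (rho y * p y).

Lemma integrand_le f p M N K : (forall y, `|T f y| <= M) -> (forall y, `|p y| <= N) ->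
  (forall y, `|rho y| <= K) ->
  forall y, `|integrand f p y| <= (2 * (M + M) + K * N) * N * `|rho y|.
Proof.
move=> TM pN rK y; rewrite /integrand normrM [X in _ * X]normrM.
rewrite -[leRHS]mulrA [X in _ * X <= _]mulrC; apply: ler_pM; rewrite ?mulr_ge0//.
  rewrite (le_trans (ler_normB _ _))// lerD// normrM; last exact: ler_pM.
  by rewrite ger0_norm// ler_wpM2l// /increment (le_trans (ler_normB _ _))// lerD.
by rewrite ler_wpM2r.
Qed.

Let measurable_integrand f p : bounded_borel f -> bounded_borel p ->
  measurable_fun [set: borel H] (integrand f p : borel H -> R).
Proof.
move=> bf bp; have br := bb trig_rho.
suff /bounded_borelP[] : bounded_borel (integrand f p) by [].
have bi := bounded_borel_increment bf.
apply: bounded_borelM; last exact: bounded_borelM.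
apply: bounded_borelB; last exact: bounded_borelM.
by apply: bounded_borelM => //; exact: bounded_borel_cst.
Qed.

Let integrable_dominant C : nu.-integrable setT (EFin \o (fun y : borel H => C * `|rho y|)).
Proof. exact: (integrableZl measurableT C (integrable_norm integrable_rho)). Qed.

Lemma integrand_trig f p : trig f -> trig p ->
  t * \int[nu]_y integrand f p y <= E t (fun y => f y ^+ 2).
Proof.
move=> tf tp.
pose q y := rho y * p y.
have tq : trig q by exact: trigM.
have jq : has_jump_limit ip P L nu t q by exact: rho_jump.
have jq2 : has_jump_limit ip P L nu t (fun y => q y ^+ 2).
  have := rho_jump (trigM tp tq); congr has_jump_limit; apply/funext => y.
  by rewrite /q; ring.
have jgq g : trig g -> has_jump_limit ip P L nu t (fun y => g y * q y).
  move=> tg; have := rho_jump (trigM tg tp); congr has_jump_limit.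
  by apply/funext => y; rewrite /q; ring.
apply: le_trans (trig_gradient_bound ip_norm mL L_triplet t_gt0 tf tq jq jq2 jgq).
have [_ iq _] := jq; have [_ iq2 _] := jq2.
have [_ iTq _] : has_jump_limit ip P L nu t (fun y => T f y * q y).
  by apply: jgq; apply: trig_wexpect => //; exact: bounded_borel_cst.
have i1 := integrableZl measurableT (T f 0) iq.
have i2 := integrableB measurableT iTq i1.
have i3 := integrableZl measurableT 2 i2.
rewrite -(RintegralZl (T f 0))// -RintegralB// -(RintegralZl 2)// -RintegralB//.
rewrite ler_pM2l// le_eqVlt; apply/orP; left; apply/eqP.
by apply: eq_Rintegral => y _; rewrite /integrand /increment /q; ring.
Qed.

(** Induction on [p] for [f] in the closure, then on [f] for [p] trigonometric. The dominating
    function depends on [f] and [p] only through their bounds, hence is common to each approximating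
    sequence. *)
Lemma integrand_bounded_borel f p : bounded_borel f -> bounded_borel p ->
  t * \int[nu]_y integrand f p y <= E t (fun y => f y ^+ 2).
Proof.
have [K rK] := trig_bounded trig_rho.
move=> /bounded_borel_bclosure clf /bounded_borel_bclosure.
elim=> [{}p tp|u N {}p clu IH uN up]; last first.
  have bf : bounded_borel f by exact/bounded_borel_bclosure.
  have /bounded_borelP[_ [M fM]] := bf.
  have bu n : bounded_borel (u n) by exact/bounded_borel_bclosure.
  have [||||_ lim] := @dominated_cvg_Rintegral _ (borel H) R nu
    (fun n => integrand f (u n)) (integrand f p)
    (fun y => (2 * (M + M) + K * N) * N * `|rho y|).
  - by move=> n; exact: measurable_integrand.
  - move=> y; apply: cvgM; last by apply: cvgMr; exact: up.
    by apply: cvgB; [exact: cvg_cst|apply: cvgMr; exact: up].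
  - exact: integrable_dominant.
  - move=> n y; apply: integrand_le => //; exact: wexpect1_norm_le.
  have lim2 : t * \int[nu]_y integrand f (u n) y @[n --> \oo] -->
    t * \int[nu]_y integrand f p y by exact: cvgMr.
  rewrite -(cvg_lim _ lim2)//; apply: limr_le; first exact: cvgP lim2.
  exact: nearW.
have bp := bb tp; have [N pN] := trig_bounded tp.
elim: clf => [g tg|u M g clu IH uM ug]; first exact: integrand_trig.
have bu n : bounded_borel (u n) by exact/bounded_borel_bclosure.
have bg : bounded_borel g.
  by apply/bounded_borel_bclosure; exact: bclosure_lim clu uM ug.
have [||||_ lim] := @dominated_cvg_Rintegral _ (borel H) R nu
  (fun n => integrand (u n) p) (integrand g p)
  (fun y => (2 * (M + M) + K * N) * N * `|rho y|).
- by move=> n; exact: measurable_integrand.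
- move=> y; apply: cvgMl; apply: cvgB; last exact: cvg_cst.
  by apply: cvgMr; apply: cvgB; exact: wexpect1_cvg uM ug _.
- exact: integrable_dominant.
- move=> n y; apply: integrand_le => // z; exact: wexpect1_norm_le (uM n) z.
have lim2 : t * \int[nu]_y integrand (u n) p y @[n --> \oo] -->
  t * \int[nu]_y integrand g p y by exact: cvgMr.
have lim3 : E t (fun y => u n y ^+ 2) @[n --> \oo] --> E t (fun y => g y ^+ 2).
  apply: (@expect_cvg _ _ _ _ P L mL t (fun n y => u n y ^+ 2)
    (fun y => g y ^+ 2) (M ^+ 2)) => // [n|n x|x].
  - exact: bounded_borelX.
  - by rewrite normrX lerXn2r ?nnegrE// (le_trans _ (uM n x)).
  - by under eq_fun do rewrite expr2; rewrite expr2; apply: cvgM; exact: ug.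
rewrite -(cvg_lim _ lim2)// -(cvg_lim _ lim3)//; apply: ler_lim.
- exact: cvgP lim2.
- exact: cvgP lim3.
- exact: nearW.
Qed.

End weight.


(** A single bump vanishes on the whole hyperplane orthogonal to its direction. Finite sums remain
    trigonometric polynomials, and along a dense sequence they eventually become positive at each
    nonzero point. *)
Definition cos_bumps (e : nat -> H) n y := \sum_(k < n) cos_bump ip (e k) y.

Lemma cos_bumps_ge0 e n y : 0 <= cos_bumps e n y.
Proof. by apply: sumr_ge0 => k _; exact: sqr_ge0. Qed.

Lemma cos_bumps_le e n k y : (n <= k)%N -> cos_bumps e n y <= cos_bumps e k y.
Proof.
move=> /subnK <-; elim: (k - n)%N => [|j IH]; first by rewrite add0n.
by rewrite addSn (le_trans IH)// /cos_bumps big_ord_recr/= lerDl sqr_ge0.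
Qed.

Lemma trig_cos_bumps e n : trig (cos_bumps e n).
Proof.
elim: n => [|n IH]; rewrite /cos_bumps.
  by under eq_fun do rewrite big_ord0; exact: trig_cst.
by under eq_fun do rewrite big_ord_recr/=; apply: trigD IH (trig_cos_bump ip (e n)).
Qed.

Lemma has_jump_limit_cos_bumps e n g : trig g ->
  has_jump_limit ip P L nu t (fun y => cos_bumps e n y * g y).
Proof.
move=> tg; elim: n => [|n IH].
  have := has_jump_limitZ ip_norm mL t_gt0 0
    (has_jump_limit_cos_bump ip_norm mL L_triplet t_gt0 (e 0%N) tg).
  congr has_jump_limit; apply/funext => y.
  by rewrite /cos_bumps big_ord0 !mul0r.
have := has_jump_limitD ip_norm mL t_gt0 IH
  (has_jump_limit_cos_bump ip_norm mL L_triplet t_gt0 (e n) tg).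
congr has_jump_limit; apply/funext => y.
by rewrite /cos_bumps big_ord_recr/= mulrDl.
Qed.

Lemma cos_bumps_gt0 e y : (forall U, open U -> U !=set0 -> exists n, U (e n)) ->
  y != 0 -> exists n, 0 < cos_bumps e n y.
Proof.
move=> dense_e y0.
have [||n /= /andP[n0 npi]] := dense_e [set z | 0 < ip y z < pi].
- have -> : [set z | 0 < ip y z < pi] = ip y @^-1` `]0, pi[.
    by apply/seteqP; split => z /=; rewrite in_itv.
  have /continuousP cy := continuous_ip ip_norm (x := y).
  exact/cy/interval_open.
(* At this point the inner product with [y] equals 1, which lies in []0, pi[]. A nearby [e n] then
   gives a nonzero sine, hence a cosine different from 1. *)
- exists (`|y| ^- 2 *: y) => /=; rewrite ipZr ip_norm mulVf ?ltr01/=.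
    by have := pi_ge2 R; lra.
  by rewrite sqrf_eq0 normr_eq0.
exists n.+1; rewrite /cos_bumps big_ord_recr/= ltr_wpDl ?cos_bumps_ge0//.
have spos : 0 < sin (ip (e n) y) by rewrite ipC; apply: sin_gt0_pi; rewrite n0.
rewrite /cos_bump exprn_even_gt0//= subr_eq0 eq_sym; apply/eqP => c1.
have := cos2Dsin2 (ip (e n) y); rewrite c1 expr1n => /eqP.
rewrite -subr_eq0 addrAC subrr add0r sqrf_eq0 => /eqP s0.
by rewrite s0 ltxx in spos.
Qed.

Lemma increment_sqr_restricted f e n : bounded_borel f ->
  (\int[nu]_y (increment f y ^+ 2 *
    \1_[set z : borel H | n.+1%:R^-1 <= cos_bumps e n z] y)%:E <=
  (t^-1 * E t (fun y => f y ^+ 2))%:E)%E.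
Proof.
move=> bf; set B := [set z | _].
have bi := bounded_borel_increment bf.
have br : bounded_borel (cos_bumps e n) by exact: bb (trig_cos_bumps e n).
have mr : measurable_fun [set: borel H] (cos_bumps e n : borel H -> R).
  by have /bounded_borelP[] := br.
have mB : measurable B by exact: measurable_superlevel.
have bB : bounded_borel (\1_B : H -> R).
  apply/bounded_borelP; split; first exact: measurable_indic.
  by exists 1 => y; rewrite indicE; case: (_ \in _); rewrite ?normr1 ?normr0.
(* This makes [rho * p] equal to [increment f] on [B] and 0 elsewhere, the maximizer of
   [2 g q - q^2] on [B]; the factor [1 / rho] is at most [n + 1] there. *)
pose p y := increment f y * (\1_B y * cos_bumps e n y `^ (-1)).
have bp : bounded_borel p.
  apply: bounded_borelM => //; apply/bounded_borelP; split.
    apply: measurable_funM; first exact: measurable_indic.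
    exact: (measurableT_comp (measurable_powR _) mr).
  exists n.+1%:R => y; rewrite indicE.
  have [/set_mem/= By|_] := boolP (y \in B); last by rewrite mul0r normr0.
  have r0 : 0 < cos_bumps e n y by exact: lt_le_trans By.
  rewrite mul1r powR_inv1 ?(ltW r0)// gtr0_norm ?invr_gt0//.
  by rewrite -[leRHS]invrK lef_pV2 ?posrE ?invr_gt0.
have rp y : cos_bumps e n y * p y = increment f y * \1_B y.
  rewrite /p indicE.
  have [/set_mem/= By|_] := boolP (y \in B); last by rewrite mul0r !mulr0.
  have r0 : 0 < cos_bumps e n y by exact: lt_le_trans By.
  by rewrite mul1r powR_inv1 ?(ltW r0)// mulrCA divff ?gt_eqF.
have gE y : integrand (cos_bumps e n) f p y = increment f y ^+ 2 * \1_B y.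
  rewrite /integrand rp indicE; case: (_ \in _) => /=; ring.
have := integrand_bounded_borel (trig_cos_bumps e n) (has_jump_limit_cos_bumps e n) bf bp.
under eq_Rintegral do rewrite gE.
rewrite -ler_pdivlMl// -lee_fin.
apply: le_trans; rewrite /Rintegral fineK//.
apply: integrable_fin_num => //.
have [K rK] := trig_bounded (trig_cos_bumps e n).
have /bounded_borelP[_ [M fM]] := bf; have /bounded_borelP[_ [N pN]] := bp.
have [_ ir _] : has_jump_limit ip P L nu t (cos_bumps e n).
  have := has_jump_limit_cos_bumps e n (trig_cst ip 1); congr has_jump_limit.
  by apply/funext => y; rewrite mulr1.
apply: le_integrable (integrableZl measurableT ((2 * (M + M) + K * N) * N)
  (integrable_norm ir)) => //.
- apply/measurable_EFinP; have /bounded_borelP[] // : bounded_borel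
    (fun y => increment f y ^+ 2 * \1_B y).
  by apply: bounded_borelM => //; exact: bounded_borelX.
- move=> y _ /=; rewrite -gE lee_fin (le_trans _ (ler_norm _))//.
  apply: integrand_le => //; exact: wexpect1_norm_le.
Qed.

Lemma increment_sqr_integral f : bounded_borel f ->
  (\int[nu]_y (increment f y ^+ 2)%:E <= (t^-1 * E t (fun y => f y ^+ 2))%:E)%E.
Proof.
move=> bf; have [e dense_e] := separable_dense_seq H_separable.
pose B n := [set z : borel H | n.+1%:R^-1 <= cos_bumps e n z].
pose F n (y : borel H) : \bar R := (increment f y ^+ 2 * \1_(B n) y)%:E.
have bi := bounded_borel_increment bf.
have mB n : measurable (B n).
  apply: measurable_superlevel.
  by have /bounded_borelP[] : bounded_borel (cos_bumps e n) by exact: bb (trig_cos_bumps e n).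
have limF y : F ^~ y @ \oo --> (increment f y ^+ 2)%:E.
  (* The origin lies in none of the sets [B n], but the increment vanishes there. *)
  have [->|y0] := eqVneq y 0.
    rewrite /F /increment subrr expr0n/=; under eq_fun do rewrite mul0r.
    exact: cvg_cst.
  have [k k0] := cos_bumps_gt0 dense_e y0.
  apply: cvg_near_cst; near=> n.
  rewrite /F indicE mem_set ?mulr1// /B/=.
  rewrite (@le_trans _ _ (cos_bumps e k y))//; last by apply: cos_bumps_le; near: n; exists k.
  rewrite -[leRHS]invrK lef_pV2 ?posrE ?invr_gt0// -natr1 ltW// ltr_wpDr//.
  by near: n; exact: nbhs_infty_gtr.
have mF n : measurable_fun setT (F n).
  apply/measurable_EFinP; apply: measurable_funM; last exact: measurable_indic.
  by have /bounded_borelP[] := bounded_borelX 2 bi.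
have F0 n y : setT y -> (0 <= F n y)%E by move=> _; rewrite lee_fin mulr_ge0 ?sqr_ge0.
(* The sets [B n] increase for two reasons: the bumps grow with [n] and the threshold [1/(n+1)]
   decreases. *)
have F_nd y : setT y -> nondecreasing_seq (F ^~ y).
  move=> _ k n kn; rewrite lee_fin ler_wpM2l ?sqr_ge0// !indicE.
  have [/set_mem /= By|_] := boolP (y \in B k); last by rewrite ler0n.
  rewrite mem_set//= /B/= (le_trans _ (cos_bumps_le e y kn))// (le_trans _ By)//.
  by rewrite lef_pV2 ?posrE// ler_nat.
have := @cvg_monotone_convergence _ (borel H) R nu setT measurableT F mF F0 F_nd.
have -> : (fun y => limn (F ^~ y)) = fun y => (increment f y ^+ 2)%:E.
  by apply/funext => y; exact/cvg_lim.
move=> lim; rewrite -(cvg_lim _ lim)//; apply: lime_le; first exact: cvgP lim.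
by apply: nearW => n; exact: increment_sqr_restricted.
Unshelve. all: by end_near.
Qed.

End gradient_bound.

(** * Cauchy-Schwarz and the conclusion *)

Lemma Rintegral_cauchy_schwarz d (T : measurableType d) (R : realType)
    (mu : {measure set T -> \bar R}) (f g : T -> R) :
  measurable_fun setT f -> measurable_fun setT g ->
  mu.-integrable setT (EFin \o (fun x => f x ^+ 2)) ->
  mu.-integrable setT (EFin \o (fun x => g x ^+ 2)) ->
  mu.-integrable setT (EFin \o (fun x => f x * g x)) /\
  (\int[mu]_x (f x * g x)) ^+ 2 <= \int[mu]_x (f x ^+ 2) * \int[mu]_x (g x ^+ 2).
Proof.
move=> mf mg if2 ig2.
have ifg : mu.-integrable setT (EFin \o (fun x => f x * g x)).
  apply: le_integrable (integrableD measurableT if2 ig2) => //.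
    by apply/measurable_EFinP; exact: measurable_funM.
  move=> x _ /=; rewrite lee_fin [leRHS]ger0_norm ?addr_ge0 ?sqr_ge0// normrM.
  rewrite -(real_normK (num_real (f x))) -(real_normK (num_real (g x))).
  have := sqr_ge0 (`|f x| - `|g x|); have := sqr_ge0 (`|f x| + `|g x|).
  nra.
split => //; set A := \int[mu]_x (f x ^+ 2); set B := \int[mu]_x (g x ^+ 2).
set C := \int[mu]_x _.
have A0 : 0 <= A by apply: Rintegral_ge0 => x _; exact: sqr_ge0.
have B0 : 0 <= B by apply: Rintegral_ge0 => x _; exact: sqr_ge0.
have quad (l k : R) : 0 <= l ^+ 2 * A + (2 * (l * k) * C + k ^+ 2 * B).
  have i1 := integrableZl measurableT (l ^+ 2) if2.
  have i2 := integrableZl measurableT (2 * (l * k)) ifg.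
  have i3 := integrableZl measurableT (k ^+ 2) ig2.
  rewrite -!RintegralZl// -RintegralD// -RintegralD//; last first.
    exact: (integrableD measurableT i2 i3).
  apply: Rintegral_ge0 => x _; rewrite (_ : _ + _ = (l * f x + k * g x) ^+ 2).
    exact: sqr_ge0.
  by ring.
have [A1|A1] := ltP 0 A.
  (* The pair [(- C, A)] minimizes the quadratic form up to scaling when [A > 0]. *)
  have := quad (- C) A; rewrite (_ : _ + _ = A * (A * B - C ^+ 2)); last by ring.
  by rewrite pmulr_rge0// subr_ge0.
have A00 : A = 0 by apply/eqP; rewrite eq_le A1.
(* With [A = 0] the form reduces to [2 l k C + k^2 B]; this choice gives [- (B + 2) C^2], so
   nonnegativity makes [C^2] nonpositive. *)
have := quad (- (B + 1)) C; rewrite A00 mul0r mulr0 add0r.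
rewrite (_ : _ + _ = - ((B + 2) * C ^+ 2)); last by ring.
by rewrite oppr_ge0 pmulr_rle0// ltr_wpDl.
Qed.

Theorem theorem3p1 (R : realType) (H : completeNormedModType R)
    (ip : {dot H for idfun}) (ip_norm : forall x : H, ip x x = `|x| ^+ 2)
    (H_separable : separable H)
    (d : measure_display) (Omega : measurableType d) (P : probability Omega R)
    (L : R -> Omega -> H) (L_levy : levy_process P L)
    (m : H) (Q : {linear H -> H}) (nu : {measure set (borel H) -> \bar R})
    (L_triplet : generating_triplet ip P L m Q nu)
    (q : borel H -> R) (q_L2 : q \in Lfun nu 2%:E)
    (t : R) (t_gt0 : 0 < t) (f : H -> R) (f_Bb : bounded_borel f) :
  Dq nu q (transition P L t f) /\
  forall x : H,
    `|Aq nu q (transition P L t f) x| ^+ 2 <=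
    t^-1 * transition P L t (fun y => f y ^+ 2) x * \int[nu]_y (q y ^+ 2).
Proof.
have mL := levy_measurable L_levy.
have [mq iq2] : measurable_fun setT q /\ nu.-integrable setT (EFin \o (fun y => q y ^+ 2)).
  split; last exact: Lfun2_integrable_sqr.
  by move: q_L2; rewrite inE => /andP[]; rewrite inE.
set I := \int[nu]_y (q y ^+ 2).
pose g x (y : borel H) := transition P L t f (x + y) - transition P L t f x.
(* Replacing [f] by its translate turns increments of [P_t f] at [x] into increments at the
   origin. *)
have fE x y : transition P L t f (x + y) = wexpect P L t (fun=> 1) (fun z => f (x + z)) y.
  rewrite wexpect1 transitionE; congr expect; apply/funext => z; by rewrite addrA.
have gE x : g x = increment P L t (fun z => f (x + z)).
  apply/funext => y; rewrite /g /increment fE; congr (_ - _).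
  by rewrite -{1}[x]addr0 fE.
have bfx x := bounded_borel_shift x f_Bb.
have bg x : bounded_borel (g x : H -> R).
  rewrite gE; exact: (bounded_borel_increment ip_norm H_separable P mL t_gt0 (bfx x)).
have mg x : measurable_fun setT (g x) by have /bounded_borelP[] := bg x.
have g2_le x : (\int[nu]_y (g x y ^+ 2)%:E <=
    (t^-1 * transition P L t (fun y => f y ^+ 2) x)%:E)%E.
  rewrite transitionE gE.
  exact: (increment_sqr_integral ip_norm H_separable mL L_triplet t_gt0 (bfx x)).
have ig2 x : nu.-integrable setT (EFin \o (fun y => g x y ^+ 2)).
  apply/integrableP; split; first by apply/measurable_EFinP; exact: measurable_funX.
  under eq_integral do rewrite /= ger0_norm ?sqr_ge0//.
  exact: le_lt_trans (g2_le x) (ltry _).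
have Rg2_le x : \int[nu]_y (g x y ^+ 2) <= t^-1 * transition P L t (fun y => f y ^+ 2) x.
  rewrite -lee_fin /Rintegral fineK; first exact: g2_le.
  exact: (integrable_fin_num measurableT (ig2 x)).
split; last first.
  move=> x; have [_] := Rintegral_cauchy_schwarz (mg x) mq (ig2 x) iq2.
  rewrite /Aq real_normK ?num_real// => /le_trans; apply.
  by apply: ler_wpM2r (Rg2_le x); apply: Rintegral_ge0 => y _; exact: sqr_ge0.
have /bounded_borelP[_ [M fM]] := f_Bb.
have tr_le x : transition P L t (fun y => f y ^+ 2) x <= M ^+ 2.
  rewrite transitionE; have f2M y : `|f y ^+ 2| <= M ^+ 2.
    by rewrite normrX lerXn2r ?nnegrE// (le_trans _ (fM y)).
  have := expect_norm_le P mL t_gt0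
    (bounded_borel_shift x (bounded_borelX 2 f_Bb)) (fun y => f2M (x + y)).
  exact/le_trans/ler_norm.
split.
  have := bounded_borel_wexpect1 ip_norm H_separable P mL t_gt0 f_Bb.
  congr bounded_borel; apply/funext => x.
  by rewrite transitionE wexpect1.
(* Membership in [Dq] needs a bound uniform in [x]: [|g q| <= g^2 + q^2], where the integral of
   [g^2] is at most [P_t f^2 / t], hence at most [M^2 / t]. *)
apply: (@le_lt_trans _ _ (t^-1 * M ^+ 2 + I)%:E); last exact: ltry.
apply: ge_ereal_sup => _ [x _ <-].
have mg2 : measurable_fun setT (fun y => g x y ^+ 2) by exact: measurable_funX.
have mq2 : measurable_fun setT (fun y => q y ^+ 2) by exact: measurable_funX.
apply: (@le_trans _ _ (\int[nu]_y ((g x y ^+ 2)%:E + (q y ^+ 2)%:E))%E).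
  apply: ge0_le_integral => //.
  - apply/measurable_EFinP; apply: measurable_funM.
      exact: (measurableT_comp (@normr_measurable R setT) (mg x)).
    exact: (measurableT_comp (@normr_measurable R setT) mq).
  - by apply/measurable_EFinP; exact: measurable_funD.
  - move=> y _; rewrite lee_fin -/(g x y).
    have := sqr_ge0 (`|g x y| - `|q y|).
    rewrite -(real_normK (num_real (g x y))) -(real_normK (num_real (q y))).
    by have := normr_ge0 (g x y); have := normr_ge0 (q y); nra.
rewrite (integralD measurableT (ig2 x) iq2) EFinD; apply: leeD.
  by apply: le_trans (g2_le x) _; rewrite lee_fin ler_wpM2l// invr_ge0 ltW.
by rewrite /I /Rintegral fineK// integrable_fin_num.
Qed.
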